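(* Let $\chi$ be a bicharacter on $\mathbb Z^I$ with values in $\Bbbk^\times$, let $p\in I$, and assume that $b=b^\chi(\alpha_p)<\infty$. Let $\Lambda\in\mathrm{Hom}(\mathcal U^0,\mathbb K^\times)$. Assume that $\Lambda(K_pL_p^{-1})\ne\chi(\alpha_p,\alpha_p)^{t-1}$ for all $t\in\{1,2,\dots,b-1\}$. Then the maps $$\hat T_p,\hat T_p^-:M^{r_p(\chi)}(t_p^\chi(\Lambda))\to M^\chi(\Lambda)$$ are isomorphisms of vector spaces over $\mathbb K$.
   Context: Let $\Bbbk$ be a field, $\Bbbk^\times=\Bbbk\setminus\{0\}$, $\mathbb K$ a field extension of $\Bbbk$, $\mathbb K^\times=\mathbb K\setminus\{0\}$, $\mathbb N=\{1,2,\dots\}$, $\mathbb N_0=\mathbb N\cup\{0\}$, $(n)_q=\sum_{j=0}^{n-1}q^j$, $(n)^!_q=\prod_{j=1}^n(j)_q$. $I$ is a non-empty finite set, $\{\alpha_i\mid i\in I\}$ the standard basis of $\mathbb Z^I$. A bicharacter $\chi:\mathbb Z^I\times\mathbb Z^I\to\Bbbk^\times$ is multiplicative in each argument; $\chi^{-1}(a,b)=\chi(a,b)^{-1}$; $w^*\chi(a,b)=\chi(w^{-1}(a),w^{-1}(b))$ for $w\in\mathrm{Aut}(\mathbb Z^I)$; $q_{ij}=\chi(\alpha_i,\alpha_j)$. $\chi$ is $p$-finite if for all $j\in I\setminus\{p\}$ there is $m\in\mathbb N_0$ with $(m+1)_{q_{pp}}=0$ or $q_{pp}^mq_{pj}q_{jp}=1$;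 then $c^\chi_{pp}=2$, $c^\chi_{pj}=-\min\{m\in\mathbb N_0\mid(m+1)_{q_{pp}}(q_{pp}^mq_{pj}q_{jp}-1)=0\}$ for $j\ne p$, $\sigma^\chi_p(\alpha_j)=\alpha_j-c^\chi_{pj}\alpha_p$, $r_p(\chi)=(\sigma^\chi_p)^*\chi$. One has $r_p^2(\chi)=\chi$, $\sigma_p^{r_p(\chi)}=\sigma_p^\chi$. $b^\chi(\alpha)=\min\{m\in\mathbb N\mid(m)_{\chi(\alpha,\alpha)}=0\}$ ($\infty$ if there is no such $m$); if $b^\chi(\alpha_p)<\infty$, then $\chi$ and $r_p(\chi)$ are $p$-finite and $b^{r_p(\chi)}(\alpha_p)=b^\chi(\alpha_p)$. Algebras. $\mathcal U(\chi)$ is the unital associative $\Bbbk$-algebra with generators $K_i^{\pm1},L_i^{\pm1},E_i,F_i$ ($i\in I$) and relations: all $K_i^{\pm1},L_i^{\pm1}$ commute, $K_iK_i^{-1}=L_iL_i^{-1}=1$, $K_iE_jK_i^{-1}=q_{ij}E_j$, $L_iE_jL_i^{-1}=q_{ji}^{-1}E_j$, $K_iF_jK_i^{-1}=q_{ij}^{-1}F_j$, $L_iF_jL_i^{-1}=q_{ji}F_j$, $E_iF_j-F_jE_i=\delta_{ij}(K_i-L_i)$; it is $\mathbb Z^I$-graded with $\deg E_i=\alpha_i=-\deg F_i$, $K_i^{\pm1},L_i^{\pm1}$ of degree $0$. $\mathcal U^+(\chi),\mathcal U^-(\chi),\mathcal U^0$ are the subalgebras generated by the $E_i$, the $F_i$,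 and the $K_i^{\pm1},L_i^{\pm1}$ ($\mathcal U^0$ is the same Laurent polynomial ring for all $\chi$). $K_\alpha=\prod K_i^{m_i}$, $L_\alpha=\prod L_i^{m_i}$ for $\alpha=\sum m_i\alpha_i$. $\Omega$ is the antiautomorphism fixing $K_i,L_i$ and exchanging $E_i,F_i$. There are unique linear maps $\partial^K_i,\partial^L_i$ of $\mathcal U^+(\chi)$ with $EF_i-F_iE=\partial^K_i(E)K_i-L_i\partial^L_i(E)$. $\mathcal I^+(\chi)$ is the unique maximal ideal of $\mathcal U^+(\chi)$ among those contained in the kernel of the algebra map $\varepsilon$ with $\varepsilon(E_i)=0$ and stable under all $\partial^K_i$; $\mathcal I^-(\chi)=\Omega(\mathcal I^+(\chi))$. $U^\pm(\chi)=\mathcal U^\pm(\chi)/\mathcal I^\pm(\chi)$, $U(\chi)=\mathcal U(\chi)/(\mathcal I^+(\chi),\mathcal I^-(\chi))$; multiplication $U^-(\chi)\otimes\mathcal U^0\otimes U^+(\chi)\to U(\chi)$ is bijective. Lusztig isomorphisms. Let $\chi$ be $p$-finite. For $i\ne p$ define in $U(\chi)$ (for any $p$-finite $\chi$): $E^\pm_{i,0}=E_i$, $E^+_{i,m+1}=E_pE^+_{i,m}-K_pE^+_{i,m}K_p^{-1}E_p$, $E^-_{i,m+1}=E_pE^-_{i,m}-L_pE^-_{i,m}L_p^{-1}E_p$, $F^\pm_{i,0}=F_i$, $F^+_{i,m+1}=F_pF^+_{i,m}-L_pF^+_{i,m}L_p^{-1}F_p$, $F^-_{i,m+1}=F_pF^-_{i,m}-K_pF^-_{i,m}K_p^{-1}F_p$,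 and $\lambda_i^\chi=(-c^\chi_{pi})^!_{q_{pp}}\prod_{j=0}^{-c^\chi_{pi}-1}(q_{pp}^jq_{pi}q_{ip}-1)\neq0$. With $c_{pi}=c^\chi_{pi}$, there are unique algebra isomorphisms $T_p,T_p^-:U(\chi)\to U(r_p(\chi))$ such that, for $i\ne p$: $T_p(K_p)=T_p^-(K_p)=K_p^{-1}$, $T_p(L_p)=T_p^-(L_p)=L_p^{-1}$, $T_p(K_i)=T_p^-(K_i)=K_iK_p^{-c_{pi}}$, $T_p(L_i)=T_p^-(L_i)=L_iL_p^{-c_{pi}}$, $T_p(E_p)=F_pL_p^{-1}$, $T_p(F_p)=K_p^{-1}E_p$, $T_p(E_i)=E^+_{i,-c_{pi}}$, $T_p(F_i)=(\lambda_i^{r_p(\chi)})^{-1}F^+_{i,-c_{pi}}$, $T_p^-(E_p)=K_p^{-1}F_p$, $T_p^-(F_p)=E_pL_p^{-1}$, $T_p^-(E_i)=(\lambda_i^{r_p(\chi^{-1})})^{-1}E^-_{i,-c_{pi}}$, $T_p^-(F_i)=(-1)^{c_{pi}}F^-_{i,-c_{pi}}$. Verma modules. $\mathrm{Hom}(\mathcal U^0,\mathbb K^\times)$ is the set of $\mathbb K^\times$-valued characters of $\mathcal U^0$ (viewed as a group algebra). For such $\Lambda$, $\mathbb K_\Lambda=\mathbb K1_\Lambda$ is the $U^+(\chi)\mathcal U^0$-module with $uE1_\Lambda=\varepsilon(E)\Lambda(u)1_\Lambda$ for $E\in U^+(\chi)$, $u\in\mathcal U^0$, and $M^\chi(\Lambda)=U(\chi)\otimes_{U^+(\chi)\mathcal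 U^0}\mathbb K_\Lambda$, $v_\Lambda=1\otimes1_\Lambda$. If $b=b^\chi(\alpha_p)<\infty$, then $t_p^\chi(\Lambda)$ is the character of $\mathcal U^0$ with $$t_p^\chi(\Lambda)(K_{\sigma_p^\chi(\alpha)}L_{\sigma_p^\chi(\beta)})=\Lambda(K_\alpha L_\beta)\,\chi(\alpha_p,\beta)^{b-1}\chi(\alpha,\alpha_p)^{1-b}\quad(\alpha,\beta\in\mathbb Z^I),$$ and $\hat T_p,\hat T_p^-:M^{r_p(\chi)}(t_p^\chi(\Lambda))\to M^\chi(\Lambda)$ are the unique (well-defined) $\mathbb K$-linear maps with $\hat T_p(uv_{t_p^\chi(\Lambda)})=T_p(u)F_p^{b-1}v_\Lambda$ and $\hat T_p^-(uv_{t_p^\chi(\Lambda)})=T_p^-(u)F_p^{b-1}v_\Lambda$ for all $u\in U(r_p(\chi))$, where $T_p,T_p^-:U(r_p(\chi))\to U(\chi)$. *)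

(* Defs.v *)
From HB Require Import structures.
From mathcomp Require Import all_boot all_order all_algebra.
From mathcomp Require Import finmap boolp monalg zify.

Set Implicit Arguments.
Unset Strict Implicit.
Unset Printing Implicit Defensive.

Import Order.TTheory GRing.Theory Num.Theory.
Local Open Scope ring_scope.
Local Open Scope quotient_scope.

(* Quotients of modules and of noncommutative algebras.  The library only has
   ring quotients by decidable ideals of commutative rings, hence the
   following construction for submodules and two-sided ideals given by
   Prop-valued predicates. *)

Section ModuleQuotient.
Variables (R : pzRingType) (V : lmodType R).

Record submod := Submod {
  submod_pred :> V -> Prop;
  submod0 : submod_pred 0;
  submodD : forall x y, submod_pred x -> submod_pred y -> submod_pred (x + y);
  submodZ : forall a x, submod_pred x -> submod_pred (a *: x) }.

Variable N : submod.

Lemma submodN x : N x -> N (- x).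
Proof. by move=> /(submodZ (-1)); rewrite scaleN1r. Qed.

Definition submod_eq (x y : V) : bool := `[< N (x - y) >].

Lemma submod_eq_class : equiv_class_of submod_eq.
Proof.
split=> [x|x y|y x z].
- by apply/asboolP; rewrite subrr; exact: submod0.
- by apply: asbool_equiv_eq; split=> /submodN; rewrite opprB.
- move=> /asboolP h1 /asboolP h2; apply/asboolP.
  by rewrite -(subrKA y); exact: submodD.
Qed.

Canonical submod_equiv := EquivRelPack submod_eq_class.

(* The quotient V / N.  It is wrapped in a record, and its operations are
   sealed, to prevent unification from unfolding them. *)
Record quotmod := QuotMod { quotmod_val : {eq_quot submod_equiv} }.

HB.instance Definition _ := [isNew for quotmod_val].
HB.instance Definition _ := [Choice of quotmod by <:].

End ModuleQuotient.

HB.lock Definition qrepr (R : pzRingType) (V : lmodType R) (N : submod V)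
  (x : quotmod N) : V := repr (quotmod_val x).
HB.lock Definition qproj (R : pzRingType) (V : lmodType R) (N : submod V)
  (x : V) : quotmod N :=
  QuotMod (\pi_{eq_quot submod_equiv N} x).
HB.lock Definition qadd (R : pzRingType) (V : lmodType R) (N : submod V)
  (x y : quotmod N) : quotmod N := qproj N (qrepr x + qrepr y).
HB.lock Definition qopp (R : pzRingType) (V : lmodType R) (N : submod V)
  (x : quotmod N) : quotmod N := qproj N (- qrepr x).
HB.lock Definition qscale (R : pzRingType) (V : lmodType R) (N : submod V)
  (a : R) (x : quotmod N) : quotmod N := qproj N (a *: qrepr x).

Section ModuleQuotientTheory.
Variables (R : pzRingType) (V : lmodType R) (N : submod V).
Local Notation quotmod := (quotmod N).
Local Notation qproj := (qproj N).
Local Notation qadd := (@qadd R V N).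
Local Notation qopp := (@qopp R V N).
Local Notation qscale := (@qscale R V N).

Lemma qprojP (y : quotmod) : exists x, y = qproj x.
Proof. by exists (qrepr y); rewrite qproj.unlock qrepr.unlock reprK; case: y. Qed.

Lemma qproj_eq x y : qproj x = qproj y <-> N (x - y).
Proof.
rewrite qproj.unlock; split=> [[/eqmodP /asboolP //]|h].
by congr QuotMod; apply/eqmodP; exact/asboolP.
Qed.

Lemma qrepr_qproj x : N (qrepr (qproj x) - x).
Proof. by rewrite -qproj_eq qproj.unlock qrepr.unlock reprK. Qed.

Lemma qaddE x y : qadd (qproj x) (qproj y) = qproj (x + y).
Proof.
rewrite qadd.unlock; apply/qproj_eq; rewrite opprD addrACA.
by apply: submodD; exact: qrepr_qproj.
Qed.

Lemma qoppE x : qopp (qproj x) = qproj (- x).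
Proof.
by rewrite qopp.unlock; apply/qproj_eq; rewrite -opprD; exact/submodN/qrepr_qproj.
Qed.

Lemma qscaleE a x : qscale a (qproj x) = qproj (a *: x).
Proof.
by rewrite qscale.unlock; apply/qproj_eq; rewrite -scalerBr;
  exact/submodZ/qrepr_qproj.
Qed.

Lemma qaddA : associative qadd.
Proof.
move=> x y z; have [x' ->] := qprojP x; have [y' ->] := qprojP y; have [z' ->] := qprojP z.
by rewrite !qaddE addrA.
Qed.
Lemma qaddC : commutative qadd.
Proof.
by move=> x y; have [x' ->] := qprojP x; have [y' ->] := qprojP y; rewrite !qaddE addrC.
Qed.
Lemma qadd0 : left_id (qproj 0) qadd.
Proof. by move=> x; have [x' ->] := qprojP x; rewrite qaddE add0r. Qed.
Lemma qaddN : left_inverse (qproj 0) qopp qadd.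
Proof. by move=> x; have [x' ->] := qprojP x; rewrite qoppE qaddE addNr. Qed.

HB.instance Definition _ := GRing.isZmodule.Build quotmod qaddA qaddC qadd0 qaddN.

Lemma qprojD x y : qproj (x + y) = qproj x + qproj y.
Proof. by rewrite -qaddE. Qed.

Lemma qscaleA a b v : qscale a (qscale b v) = qscale (a * b) v.
Proof. by have [v' ->] := qprojP v; rewrite !qscaleE scalerA. Qed.
Lemma qscale1 : left_id 1 qscale.
Proof. by move=> v; have [v' ->] := qprojP v; rewrite qscaleE scale1r. Qed.
Lemma qscaleDr : right_distributive qscale +%R.
Proof.
move=> a x y; have [x' ->] := qprojP x; have [y' ->] := qprojP y.
by rewrite -qprojD !qscaleE -qprojD scalerDr.
Qed.
Lemma qscaleDl v : {morph qscale^~ v : a b / a + b}.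
Proof.
move=> a b; have [v' ->] := qprojP v.
by rewrite !qscaleE -qprojD scalerDl.
Qed.

HB.instance Definition _ :=
  GRing.Zmodule_isLmodule.Build R quotmod qscaleA qscale1 qscaleDr qscaleDl.

Lemma qproj_is_linear : linear qproj.
Proof. by move=> a x y; rewrite qprojD -qscaleE. Qed.
HB.instance Definition _ := GRing.isLinear.Build R V quotmod _ qproj qproj_is_linear.

Lemma qproj_eq0 x : qproj x = 0 <-> N x.
Proof.
by rewrite -[0]/(qproj 0) qproj_eq subr0.
Qed.

End ModuleQuotientTheory.

Section Lift.
Variables (R : pzRingType) (V W : lmodType R) (N : submod V).
Variables (f : {linear V -> W}) (fN : forall x, N x -> f x = 0).

Definition qlift (x : quotmod N) : W := let _ := fN in f (qrepr x).

Lemma qliftE x : qlift (qproj N x) = f x.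
Proof.
by apply/eqP; rewrite -subr_eq0 -linearB; apply/eqP/fN/qrepr_qproj.
Qed.

Lemma qlift_is_linear : linear qlift.
Proof.
move=> a x y; have [u ->] := qprojP x; have [v ->] := qprojP y.
by rewrite -linearP !qliftE linearP.
Qed.
HB.instance Definition _ :=
  GRing.isLinear.Build R (quotmod N) W _ qlift qlift_is_linear.

End Lift.

Section Span.
Variables (R : pzRingType) (V : lmodType R) (S : V -> Prop).

Inductive in_span : V -> Prop :=
| in_span0 : in_span 0
| in_spanS x : S x -> in_span x
| in_spanD x y : in_span x -> in_span y -> in_span (x + y)
| in_spanZ a x : in_span x -> in_span (a *: x).

Definition spanned := Submod in_span0 in_spanD in_spanZ.

End Span.

Section AlgebraQuotient.
Variables (k : fieldType) (A : algType k).

(* proper two-sided ideals; properness makes the quotient a nonzero ring, as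
   required by [algType] *)
Record ideal := Ideal {
  ideal_pred :> A -> Prop;
  ideal0 : ideal_pred 0;
  idealD : forall x y, ideal_pred x -> ideal_pred y -> ideal_pred (x + y);
  idealMl : forall a x, ideal_pred x -> ideal_pred (a * x);
  idealMr : forall a x, ideal_pred x -> ideal_pred (x * a);
  ideal_proper : ~ ideal_pred 1 }.

Variable J : ideal.

Lemma idealZ c x : J x -> J (c *: x).
Proof. by move=> /(idealMl c%:A); rewrite -scalerAl mul1r. Qed.

Definition ideal_submod := Submod (ideal0 J) (@idealD J) idealZ.

Definition quotalg := quotmod ideal_submod.

HB.instance Definition _ := GRing.Lmodule.on quotalg.

Definition aproj : A -> quotalg := @qproj _ _ ideal_submod.
HB.instance Definition _ := GRing.Linear.on aproj.

Lemma aprojP (y : quotalg) : exists x, y = aproj x.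
Proof. exact: qprojP. Qed.

Lemma aproj_eq0 x : aproj x = 0 <-> J x.
Proof. exact: (qproj_eq0 ideal_submod). Qed.

End AlgebraQuotient.

HB.lock Definition qmul (k : fieldType) (A : algType k) (J : ideal A)
  (x y : quotalg J) : quotalg J := aproj J (qrepr x * qrepr y).

Section AlgebraQuotientTheory.
Variables (k : fieldType) (A : algType k) (J : ideal A).
Local Notation quotalg := (quotalg J).
Local Notation aproj := (aproj J).
Local Notation qmul := (@qmul k A J).

Lemma qmulE x y : qmul (aproj x) (aproj y) = aproj (x * y).
Proof.
rewrite qmul.unlock; apply/qproj_eq.
set x' := qrepr _; set y' := qrepr _.
have -> : x' * y' - x * y = (x' - x) * y' + x * (y' - y).
  by rewrite mulrBl mulrBr addrA subrK.
by apply: idealD; [apply: idealMr|apply: idealMl]; exact: qrepr_qproj.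
Qed.

Lemma qmulA : associative qmul.
Proof.
move=> x y z; have [u ->] := aprojP x; have [v ->] := aprojP y.
by have [w ->] := aprojP z; rewrite !qmulE mulrA.
Qed.
Lemma qmul1 : left_id (aproj 1) qmul.
Proof. by move=> x; have [u ->] := aprojP x; rewrite qmulE mul1r. Qed.
Lemma qmulr1 : right_id (aproj 1) qmul.
Proof. by move=> x; have [u ->] := aprojP x; rewrite qmulE mulr1. Qed.
Lemma qmulDl : left_distributive qmul +%R.
Proof.
move=> x y z; have [u ->] := aprojP x; have [v ->] := aprojP y.
by have [w ->] := aprojP z; rewrite -linearD !qmulE -linearD mulrDl.
Qed.
Lemma qmulDr : right_distributive qmul +%R.
Proof.
move=> x y z; have [u ->] := aprojP x; have [v ->] := aprojP y.
by have [w ->] := aprojP z; rewrite -linearD !qmulE -linearD mulrDr.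
Qed.
Lemma qone_neq0 : aproj 1 != 0.
Proof. by apply/eqP=> /aproj_eq0 /(@ideal_proper k A J). Qed.

HB.instance Definition _ := GRing.Zmodule_isNzRing.Build quotalg
  qmulA qmul1 qmulr1 qmulDl qmulDr qone_neq0.

Lemma aprojZ a x : aproj (a *: x) = a *: aproj x.
Proof. exact: linearZZ. Qed.

Lemma aprojM x y : aproj (x * y) = aproj x * aproj y.
Proof. by rewrite -qmulE. Qed.

Lemma qscaleAl (a : k) (u v : quotalg) : a *: (u * v) = (a *: u) * v.
Proof.
have [x ->] := aprojP u; have [y ->] := aprojP v.
by rewrite -(aprojM x y) -!aprojZ -(aprojM (a *: x)) scalerAl.
Qed.
HB.instance Definition _ := GRing.Lmodule_isLalgebra.Build k quotalg qscaleAl.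

Lemma qscaleAr (a : k) (u v : quotalg) : a *: (u * v) = u * (a *: v).
Proof.
have [x ->] := aprojP u; have [y ->] := aprojP v.
by rewrite -(aprojM x y) -!aprojZ -(aprojM x (a *: y)) scalerAr.
Qed.
HB.instance Definition _ := GRing.Lalgebra_isAlgebra.Build k quotalg qscaleAr.

Lemma aproj_is_monoid_morphism : monoid_morphism aproj.
Proof. by split=> // x y; rewrite aprojM. Qed.
HB.instance Definition _ :=
  GRing.isMonoidMorphism.Build A quotalg aproj aproj_is_monoid_morphism.

End AlgebraQuotientTheory.

Section LiftRing.
Variables (k : fieldType) (A : algType k) (J : ideal A) (B : nzRingType).
Variables (f : {rmorphism A -> B}) (fJ : forall x, J x -> f x = 0).

Definition alift (x : quotalg J) : B := let _ := fJ in f (qrepr x).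

Lemma aliftE x : alift (aproj J x) = f x.
Proof.
apply/eqP; rewrite -subr_eq0 -rmorphB; apply/eqP/fJ.
exact: (qrepr_qproj (ideal_submod J)).
Qed.

Lemma alift_is_zmod_morphism : zmod_morphism alift.
Proof.
move=> x y; have [u ->] := aprojP x; have [v ->] := aprojP y.
by rewrite -rmorphB !aliftE rmorphB.
Qed.
HB.instance Definition _ :=
  GRing.isZmodMorphism.Build (quotalg J) B alift alift_is_zmod_morphism.

Lemma alift_is_monoid_morphism : monoid_morphism alift.
Proof.
split=> [|x y]; first by rewrite -(rmorph1 (aproj J)) aliftE rmorph1.
have [u ->] := aprojP x; have [v ->] := aprojP y.
by rewrite -rmorphM !aliftE rmorphM.
Qed.
HB.instance Definition _ :=
  GRing.isMonoidMorphism.Build (quotalg J) B alift alift_is_monoid_morphism.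

End LiftRing.

Section GeneratedIdeal.
Variables (k : fieldType) (A : algType k) (S : A -> Prop).

Inductive in_ideal : A -> Prop :=
| in_ideal0 : in_ideal 0
| in_idealS x : S x -> in_ideal x
| in_idealD x y : in_ideal x -> in_ideal y -> in_ideal (x + y)
| in_idealMl a x : in_ideal x -> in_ideal (a * x)
| in_idealMr a x : in_ideal x -> in_ideal (x * a).

Lemma in_ideal_kernel (B : nzRingType) (f : {rmorphism A -> B}) :
  (forall x, S x -> f x = 0) -> forall x, in_ideal x -> f x = 0.
Proof.
move=> fS x; elim=> {x} [|x /fS //|x y _ hx _ hy|a x _ hx|a x _ hx].
- exact: rmorph0.
- by rewrite rmorphD hx hy addr0.
- by rewrite rmorphM hx mulr0.
- by rewrite rmorphM hx mul0r.
Qed.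

Variables (B : nzRingType) (f : {rmorphism A -> B}).
Hypothesis fS : forall x, S x -> f x = 0.

Lemma in_ideal_proper : ~ in_ideal 1.
Proof.
by move=> /(in_ideal_kernel fS) /eqP; rewrite rmorph1 (negPf (oner_neq0 _)).
Qed.

(* the two-sided ideal generated by S; the morphism f only serves to show that
   it is proper *)
Definition gen_ideal :=
  Ideal in_ideal0 in_idealD in_idealMl in_idealMr in_ideal_proper.

Inductive in_subalg : A -> Prop :=
| in_subalgC c : in_subalg c%:A
| in_subalgS x : S x -> in_subalg x
| in_subalgD x y : in_subalg x -> in_subalg y -> in_subalg (x + y)
| in_subalgM x y : in_subalg x -> in_subalg y -> in_subalg (x * y).

End GeneratedIdeal.

(* The free associative algebra on the set G: the algebra of the free monoid.
   [malg] has an [algType] structure for commutative monoids only; as above the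
   operations are sealed. *)
Definition freealg (k : fieldType) (G : choiceType) := {malg k[{fmonom G}]}.

HB.instance Definition _ k G := Choice.on (freealg k G).

HB.lock Definition fzero (k : fieldType) (G : choiceType) : freealg k G := 0 : {malg k[{fmonom G}]}.
HB.lock Definition fone (k : fieldType) (G : choiceType) : freealg k G := 1 : {malg k[{fmonom G}]}.
HB.lock Definition fopp (k : fieldType) (G : choiceType) (x : freealg k G) : freealg k G :=
  - (x : {malg k[{fmonom G}]}).
HB.lock Definition fadd (k : fieldType) (G : choiceType) (x y : freealg k G) : freealg k G :=
  (x : {malg k[{fmonom G}]}) + y.
HB.lock Definition fmul (k : fieldType) (G : choiceType) (x y : freealg k G) : freealg k G :=
  (x : {malg k[{fmonom G}]}) * y.
HB.lock Definition fscale (k : fieldType) (G : choiceType) (a : k) (x : freealg k G) : freealg k G :=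
  a *: (x : {malg k[{fmonom G}]}).

HB.lock Definition fgen (k : fieldType) (G : choiceType) (g : G) : freealg k G :=
  << fmu g >> : {malg k[{fmonom G}]}.

Section FreeAlgebra.
Variables (k : fieldType) (G : choiceType).
Local Notation freealg := (freealg k G).
Local Notation malgG := {malg k[{fmonom G}]}.
Let fE := (fzero.unlock, fone.unlock, fopp.unlock, fadd.unlock, fmul.unlock,
  fscale.unlock).

Fact faddA : associative (@fadd k G).
Proof. by move=> x y z; rewrite fE; exact: (@addrA malgG). Qed.
Fact faddC : commutative (@fadd k G).
Proof. by move=> x y; rewrite fE; exact: (@addrC malgG). Qed.
Fact fadd0 : left_id (fzero k G) (@fadd k G).
Proof. by move=> x; rewrite !fE; exact: (@add0r malgG). Qed.
Fact faddN : left_inverse (fzero k G) (@fopp k G) (@fadd k G).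
Proof. by move=> x; rewrite !fE; exact: (@addNr malgG). Qed.
HB.instance Definition _ :=
  GRing.isZmodule.Build freealg faddA faddC fadd0 faddN.

Lemma faddE (x y : freealg) : x + y = (x : malgG) + (y : malgG).
Proof. by rewrite -[LHS]/(fadd x y) fE. Qed.
Lemma foppE (x : freealg) : - x = - (x : malgG).
Proof. by rewrite -[LHS]/(fopp x) fE. Qed.

Fact fmulA : associative (@fmul k G).
Proof. by move=> x y z; rewrite fE; exact: (@mulrA malgG). Qed.
Fact fmul1 : left_id (fone k G) (@fmul k G).
Proof. by move=> x; rewrite !fE; exact: (@mul1r malgG). Qed.
Fact fmulr1 : right_id (fone k G) (@fmul k G).
Proof. by move=> x; rewrite !fE; exact: (@mulr1 malgG). Qed.
Fact fmulDl : left_distributive (@fmul k G) +%R.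
Proof. by move=> x y z; rewrite !faddE !fE; exact: (@mulrDl malgG). Qed.
Fact fmulDr : right_distributive (@fmul k G) +%R.
Proof. by move=> x y z; rewrite !faddE !fE; exact: (@mulrDr malgG). Qed.
Fact fone_neq0 : fone k G != 0.
Proof. by rewrite -[0]/(fzero k G) !fE; exact: (oner_neq0 malgG). Qed.
HB.instance Definition _ := GRing.Zmodule_isNzRing.Build freealg
  fmulA fmul1 fmulr1 fmulDl fmulDr fone_neq0.

Lemma fmulE (x y : freealg) : x * y = (x : malgG) * (y : malgG).
Proof. by rewrite -[LHS]/(fmul x y) fE. Qed.
Lemma foneE : 1 = (1 : malgG) :> freealg.
Proof. by rewrite -[LHS]/(fone k G) fE. Qed.

Fact fscaleA a b x : @fscale k G a (fscale b x) = fscale (a * b) x.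
Proof. by rewrite fE; exact: (@scalerA _ malgG). Qed.
Fact fscale1 : left_id 1 (@fscale k G).
Proof. by move=> x; rewrite fE; exact: (@scale1r _ malgG). Qed.
Fact fscaleDr : right_distributive (@fscale k G) +%R.
Proof. by move=> a x y; rewrite !faddE fE; exact: (@scalerDr _ malgG). Qed.
Fact fscaleDl x : {morph (@fscale k G)^~ x : a b / a + b}.
Proof. by move=> a b; rewrite !faddE fE; exact: (@scalerDl _ malgG). Qed.
HB.instance Definition _ := GRing.Zmodule_isLmodule.Build k freealg
  fscaleA fscale1 fscaleDr fscaleDl.

Lemma fscaleE (a : k) (x : freealg) : a *: x = a *: (x : malgG).
Proof. by rewrite -[LHS]/(fscale a x) fE. Qed.

Fact fscaleAl (a : k) (x y : freealg) : a *: (x * y) = (a *: x) * y.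
Proof. by rewrite !fscaleE !fmulE; exact: (@scalerAl _ malgG). Qed.
HB.instance Definition _ := GRing.Lmodule_isLalgebra.Build k freealg fscaleAl.

Fact fscaleAr (a : k) (x y : freealg) : a *: (x * y) = x * (a *: y).
Proof.
rewrite !fscaleE !fmulE.
have aC (z : malgG) : a *: z = z * malgC a.
  rewrite malgZ_def malgM_def fgmulgU; apply: eq_bigr => m _.
  by rewrite mulrC mulm1.
by rewrite !aC mulrA.
Qed.
HB.instance Definition _ := GRing.Lalgebra_isAlgebra.Build k freealg fscaleAr.

End FreeAlgebra.

Definition fword (G : choiceType) (B : nzRingType) (h : G -> B)
  (m : {fmonom G}) : B := \prod_(g <- (m : seq G)) h g.

(* the algebra map sending the generator g to h g; phi is the k-algebra
   structure of B *)
HB.lock Definition feval (k : fieldType) (G : choiceType) (B : nzRingType)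
  (phi : {rmorphism k -> B}) (phiC : forall c x, GRing.comm (phi c) x)
  (h : G -> B) (x : freealg k G) : B := mmap phi (fword h) x.

Section Eval.
Variables (k : fieldType) (G : choiceType).
Variables (B : nzRingType) (phi : {rmorphism k -> B}).
Hypothesis phiC : forall c x, GRing.comm (phi c) x.
Variable h : G -> B.
Local Notation fword := (fword h).
Local Notation feval := (feval phiC h).
Local Notation freealg := (freealg k G).
Local Notation fgen := (@fgen k G).

Lemma fword_is_mmorphism : mmorphism fword.
Proof.
split=> [m1 m2|]; rewrite /fword.
  by rewrite fmM big_cat.
by rewrite fm1 big_nil.
Qed.
HB.instance Definition _ :=
  isMultiplicative.Build {fmonom G} B fword fword_is_mmorphism.

Lemma feval_is_zmod_morphism : zmod_morphism feval.
Proof. by move=> x y; rewrite faddE foppE feval.unlock; exact: mmap_is_additive. Qed.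
HB.instance Definition _ :=
  GRing.isZmodMorphism.Build freealg B feval feval_is_zmod_morphism.

Lemma feval_is_monoid_morphism : monoid_morphism feval.
Proof.
have [hM h1] : multiplicative (mmap phi fword).
  by apply: commr_mmap_is_multiplicative => g m m'; exact: phiC.
by split=> [|x y]; rewrite feval.unlock ?foneE ?fmulE ?h1 ?hM.
Qed.
HB.instance Definition _ :=
  GRing.isMonoidMorphism.Build freealg B feval feval_is_monoid_morphism.

Lemma feval_gen g : feval (fgen g) = h g.
Proof.
by rewrite feval.unlock fgen.unlock mmapU /= rmorph1 mul1r /fword fmU big_seq1.
Qed.

Lemma feval_scale c x : feval (c *: x) = phi c * feval x.
Proof. by rewrite feval.unlock fscaleE mmapZ. Qed.

End Eval.

Section FreeAlgebraTheory.
Variables (k : fieldType) (G : choiceType).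
Local Notation freealg := (freealg k G).
Local Notation fgen := (@fgen k G).

Lemma malgU_word c (m : {fmonom G}) :
  << c *g m >> = c *: \prod_(g <- (m : seq G)) fgen g :> freealg.
Proof.
have -> : \prod_(g <- (m : seq G)) fgen g = << m >>.
  rewrite -[in RHS](fmK m); elim: (m : seq G) => [|g s ih].
    by rewrite big_nil -fmoneE foneE.
  rewrite big_cons ih fgen.unlock fmulE malgM_def fgmulUU mulr1 /=.
  by rewrite [in LHS]/mmul /= fmmulE fmuE.
by rewrite fscaleE; apply/malgP => m'; rewrite mcoeffZ !mcoeffU mulr_natr.
Qed.

Lemma freealg_ind (P : freealg -> Prop) :
  (forall x y, P x -> P y -> P (x + y)) ->
  (forall c s, P (c *: \prod_(g <- s) fgen g)) -> forall x, P x.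
Proof.
move=> PD PM x; rewrite (monalgE x).
have P0 : P (0 : {malg k[{fmonom G}]}).
  by have := PM 0 [::]; rewrite scale0r -[0]/(fzero k G) fzero.unlock.
elim/big_ind: _ => // [y z hy hz|m _]; first by rewrite -faddE; exact: PD.
by rewrite malgU_word; exact: PM.
Qed.

Lemma freealg_ext (B : nzRingType) (f1 f2 : {rmorphism freealg -> B}) :
  (forall c, f1 c%:A = f2 c%:A) -> (forall g, f1 (fgen g) = f2 (fgen g)) ->
  f1 =1 f2.
Proof.
move=> fC fG; apply: freealg_ind => [x y hx hy|c s]; first by rewrite !rmorphD hx hy.
rewrite -mulr_algl !rmorphM fC; congr (_ * _).
by rewrite !rmorph_prod; apply: eq_bigr => g _; rewrite fG.
Qed.

End FreeAlgebraTheory.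

Definition qnat (k : fieldType) (q : k) (n : nat) : k := \sum_(j < n) q ^+ j.
Definition qfact (k : fieldType) (q : k) (n : nat) : k :=
  \prod_(1 <= j < n.+1) qnat q j.

(* minimum of a set of natural numbers; None stands for the infinite minimum
   of the empty set *)
Definition omin (P : pred nat) : option nat :=
  if pselect (exists n, P n) is left h then Some (ex_minn h) else None.

Lemma ominP (P : pred nat) : (exists n, P n) ->
  exists m, [/\ omin P = Some m, P m & forall n, P n -> (m <= n)%N].
Proof.
by rewrite /omin => h; case: pselect => // h'; case: ex_minnP => m Pm hm; exists m.
Qed.

Notation lattice I := {ffun I -> int}.

Section Bicharacters.
Variables (k : fieldType) (I : finType).
Implicit Types (p i j : I) (a b c : lattice I).

Definition alpha i : lattice I := [ffun j => Posz (j == i)].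

Record bichar := Bichar {
  bichar_fun :> lattice I -> lattice I -> k;
  bichar_neq0 : forall a b, bichar_fun a b != 0;
  bicharDl : forall a b c, bichar_fun (a + b) c = bichar_fun a c * bichar_fun b c;
  bicharDr : forall a b c, bichar_fun a (b + c) = bichar_fun a b * bichar_fun a c }.

Implicit Types chi : bichar.

Section Inverse.
Variable chi : bichar.
Let f a b := (chi a b)^-1.
Fact bicharV_neq0 a b : f a b != 0.
Proof. by rewrite invr_neq0 ?bichar_neq0. Qed.
Fact bicharV_Dl a b c : f (a + b) c = f a c * f b c.
Proof. by rewrite /f bicharDl invfM. Qed.
Fact bicharV_Dr a b c : f a (b + c) = f a b * f a c.
Proof. by rewrite /f bicharDr invfM. Qed.
Definition bicharV := Bichar bicharV_neq0 bicharV_Dl bicharV_Dr.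
End Inverse.

Definition qij chi i j : k := chi (alpha i) (alpha j).

(* the order b^chi(a) *)
Definition border chi a : option nat :=
  omin (fun m => (0 < m)%N && (qnat (chi a a) m == 0)).

Definition cartan_cond chi p j (m : nat) : bool :=
  qnat (qij chi p p) m.+1 * (qij chi p p ^+ m * qij chi p j * qij chi j p - 1)
    == 0.

Definition pfinite chi p : Prop :=
  forall j, j != p -> exists m, cartan_cond chi p j m.

(* the natural number - c^chi_pj, for j != p *)
Definition ncartan chi p j : nat := odflt 0%N (omin (cartan_cond chi p j)).

Definition cartan chi p j : int :=
  if j == p then 2 else - (ncartan chi p j)%:Z.

(* the Z-linear map with alpha_j |-> alpha_j - c_pj alpha_p *)
Definition sigma chi p a : lattice I :=
  a - alpha p *~ (\sum_j a j * cartan chi p j).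

Lemma sigma_is_additive chi p : zmod_morphism (sigma chi p).
Proof.
move=> a b; rewrite /sigma.
have -> : \sum_j (a - b) j * cartan chi p j =
          \sum_j a j * cartan chi p j - \sum_j b j * cartan chi p j.
  by rewrite -sumrB; apply: eq_bigr => j _; rewrite !ffunE mulrBl.
by rewrite mulrzBr !opprD opprK addrACA.
Qed.
HB.instance Definition _ chi p := GRing.isZmodMorphism.Build
  (lattice I) (lattice I) (sigma chi p) (sigma_is_additive chi p).

Lemma sigma_alpha chi p j :
  sigma chi p (alpha j) = alpha j - alpha p *~ cartan chi p j.
Proof.
rewrite /sigma (bigD1 j) //= big1 ?addr0 => [|i /negPf ij].
  by rewrite ffunE eqxx mul1r.
by rewrite ffunE ij mul0r.
Qed.

Lemma sigma_alphap chi p : sigma chi p (alpha p) = - alpha p.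
Proof.
by rewrite sigma_alpha /cartan eqxx -[2]/(1 + 1 : int) mulrzDr opprD addNKr.
Qed.

Lemma sigmaK chi p : involutive (sigma chi p).
Proof.
move=> a; rewrite [X in sigma chi p X]/sigma raddfB raddfMz /=.
by rewrite sigma_alphap mulNrz opprK /sigma subrK.
Qed.

(* r_p(chi) = (sigma_p)^* chi, where sigma_p^-1 = sigma_p by [sigmaK] *)
Section Reflection.
Variables (p : I) (chi : bichar).
Let f a b := chi (sigma chi p a) (sigma chi p b).
Fact refl_neq0 a b : f a b != 0. Proof. exact: bichar_neq0. Qed.
Fact refl_Dl a b c : f (a + b) c = f a c * f b c.
Proof. by rewrite /f raddfD bicharDl. Qed.
Fact refl_Dr a b c : f a (b + c) = f a b * f a c.
Proof. by rewrite /f raddfD bicharDr. Qed.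
Definition rbichar := Bichar refl_neq0 refl_Dl refl_Dr.
End Reflection.

Lemma rbicharE p chi a b : rbichar p chi a b = chi (sigma chi p a) (sigma chi p b).
Proof. by []. Qed.

Definition lambda chi p i : k :=
  let m := ncartan chi p i in
  qfact (qij chi p p) m *
  \prod_(j < m) (qij chi p p ^+ j * qij chi p i * qij chi i p - 1).

End Bicharacters.
Arguments alpha {I} i.
Arguments bichar k I : clear implicits.

Variant gen (I : Type) :=
| gK of I | gKV of I | gL of I | gLV of I | gE of I | gF of I.

HB.instance Definition _ (I : Type) := gen_eqMixin (gen I).
HB.instance Definition _ (I : Type) := gen_choiceMixin (gen I).

Definition is_torus I (g : gen I) : bool :=
  match g with gE _ | gF _ => false | _ => true end.

Definition swapEF I (g : gen I) : gen I :=
  match g with gE i => gF i | gF i => gE i | _ => g end.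

Section DoubleAlgebra.
Variables (k : fieldType) (I : finType) (chi : bichar k I).
Local Notation F := (freealg k (gen I)).
Local Notation X := (@fgen k (gen I)).
Local Notation q := (qij chi).

(* the elements lhs - rhs for the defining relations lhs = rhs of calU(chi) *)
Inductive calU_rel : F -> Prop :=
| rel_torus s t : is_torus s -> is_torus t -> calU_rel (X s * X t - X t * X s)
| rel_KV i : calU_rel (X (gK i) * X (gKV i) - 1)
| rel_LV i : calU_rel (X (gL i) * X (gLV i) - 1)
| rel_KE i j :
    calU_rel (X (gK i) * X (gE j) * X (gKV i) - q i j *: X (gE j))
| rel_LE i j :
    calU_rel (X (gL i) * X (gE j) * X (gLV i) - (q j i)^-1 *: X (gE j))
| rel_KF i j :
    calU_rel (X (gK i) * X (gF j) * X (gKV i) - (q i j)^-1 *: X (gF j))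
| rel_LF i j :
    calU_rel (X (gL i) * X (gF j) * X (gLV i) - q j i *: X (gF j))
| rel_EF i j :
    calU_rel (X (gE i) * X (gF j) - X (gF j) * X (gE i)
              - (i == j)%:R *: (X (gK i) - X (gL i))).

Lemma idfun_comm (c x : k) : GRing.comm (idfun c) x.
Proof. exact: mulrC. Qed.

Definition eps0 : F -> k :=
  feval (phi := idfun) idfun_comm (fun g => (is_torus g)%:R).
HB.instance Definition _ := GRing.RMorphism.on eps0.

Lemma eps0_rel x : calU_rel x -> eps0 x = 0.
Proof.
have e g : eps0 (X g) = (is_torus g)%:R by exact: feval_gen.
have s c y : eps0 (c *: y) = c * eps0 y by exact: feval_scale.
case=> [s' t hs ht|i|i|i j|i j|i j|i j|i j];
  rewrite !rmorphB ?rmorphM ?rmorph1 /= ?s ?rmorphB /= ?e /= ?hs ?ht;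
  by rewrite !(mulr0, mul0r, mulr1, subrr).
Qed.

End DoubleAlgebra.

HB.lock Definition calU_ideal (k : fieldType) (I : finType) (chi : bichar k I)
  : ideal (freealg k (gen I)) := gen_ideal (@eps0_rel k I chi).

Section CalU.
Variables (k : fieldType) (I : finType) (chi : bichar k I).
Local Notation F := (freealg k (gen I)).
Local Notation X := (@fgen k (gen I)).

Definition calU := quotalg (calU_ideal chi).
HB.instance Definition _ := GRing.Algebra.on calU.

Definition calUproj : F -> calU := aproj (calU_ideal chi).
HB.instance Definition _ := GRing.LRMorphism.on calUproj.

Lemma calUprojP (y : calU) : exists x, y = calUproj x.
Proof. exact: aprojP. Qed.

Lemma calU_rel0 x : calU_rel chi x -> calUproj x = 0.
Proof.
by move=> hx; apply/aproj_eq0; rewrite calU_ideal.unlock; exact: in_idealS.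
Qed.

Definition calUgen (g : gen I) : calU := calUproj (X g).

Section CalULift.
Variables (B : nzRingType) (f : {rmorphism F -> B}).
Hypothesis f_rel : forall x, calU_rel chi x -> f x = 0.

Lemma calU_ideal0 x : calU_ideal chi x -> f x = 0.
Proof. by rewrite calU_ideal.unlock; exact: in_ideal_kernel. Qed.

Definition calUlift : calU -> B := alift calU_ideal0.
HB.instance Definition _ := GRing.RMorphism.on calUlift.

Lemma calUliftE x : calUlift (calUproj x) = f x.
Proof. exact: aliftE. Qed.
End CalULift.

(* the algebra map calU -> k with K, L |-> 1 and E, F |-> 0; it extends the
   augmentation of calU^+ *)
Definition eps : calU -> k := calUlift (@eps0_rel k I chi).
HB.instance Definition _ := GRing.RMorphism.on eps.

Lemma eps_gen g : eps (calUgen g) = (is_torus g)%:R.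
Proof. by rewrite /eps calUliftE; exact: feval_gen. Qed.

Lemma epsZ c x : eps (c *: x) = c * eps x.
Proof.
have [y ->] := calUprojP x; rewrite -linearZZ /eps !calUliftE.
exact: feval_scale.
Qed.

End CalU.

Section ReflectionInvolutive.
Variables (k : fieldType) (I : finType).
Implicit Types (chi : bichar k I) (p j : I) (a b c : lattice I).

Lemma bichar_ext chi chi' : (forall a b, chi a b = chi' a b) -> chi = chi'.
Proof.
case: chi chi' => [f f0 fl fr] [g g0 gl gr] /= e.
have fg : f = g by apply: funext => a; apply: funext => b; exact: e.
by case: _ / fg in g0 gl gr *; congr Bichar; exact: Prop_irrelevance.
Qed.

Lemma omin_eq (P : pred nat) m :
  P m -> (forall n, P n -> (m <= n)%N) -> omin P = Some m.
Proof.
move=> Pm hm; have [n [-> Pn hn]] := @ominP P (ex_intro _ m Pm).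
by congr Some; apply/eqP; rewrite eqn_leq hn ?hm.
Qed.

Lemma ominSP (P : pred nat) m :
  omin P = Some m -> P m /\ (forall n, P n -> (m <= n)%N).
Proof.
rewrite /omin; case: pselect => // h [<-].
by case: ex_minnP => n Pn hn.
Qed.

Lemma bicharNl chi a b : chi (- a) b = (chi a b)^-1.
Proof.
have z : chi 0 b = 1.
  by apply: (mulfI (bichar_neq0 chi 0 b)); rewrite -bicharDl addr0 mulr1.
apply: (mulfI (bichar_neq0 chi a b)).
by rewrite -bicharDl subrr z mulfV ?bichar_neq0.
Qed.

Lemma bicharNr chi a b : chi a (- b) = (chi a b)^-1.
Proof.
have z : chi a 0 = 1.
  by apply: (mulfI (bichar_neq0 chi a 0)); rewrite -bicharDr addr0 mulr1.
apply: (mulfI (bichar_neq0 chi a b)).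
by rewrite -bicharDr subrr z mulfV ?bichar_neq0.
Qed.

Lemma bicharMnl chi a b n : chi (a *+ n) b = chi a b ^+ n.
Proof.
elim: n => [|n ih]; last by rewrite mulrS bicharDl ih exprS.
apply: (mulfI (bichar_neq0 chi 0 b)).
by rewrite -bicharDl add0r mulr1 mulr0n.
Qed.

Lemma bicharMnr chi a b n : chi a (b *+ n) = chi a b ^+ n.
Proof.
elim: n => [|n ih]; last by rewrite mulrS bicharDr ih exprS.
apply: (mulfI (bichar_neq0 chi a 0)).
by rewrite -bicharDr add0r mulr1 mulr0n.
Qed.

Lemma sigma_alphaj chi p j : j != p ->
  sigma chi p (alpha j) = alpha j + alpha p *+ ncartan chi p j.
Proof.
by move=> /negPf jp; rewrite sigma_alpha /cartan jp mulrNz opprK -pmulrn.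
Qed.

Lemma qij_refl_pp chi p : qij (rbichar p chi) p p = qij chi p p.
Proof. by rewrite /qij rbicharE sigma_alphap bicharNl bicharNr invrK. Qed.

Lemma qij_refl_pj chi p j : j != p ->
  qij (rbichar p chi) p j = (qij chi p j * qij chi p p ^+ ncartan chi p j)^-1.
Proof.
by move=> jp; rewrite /qij rbicharE sigma_alphap sigma_alphaj // bicharNl bicharDr
  bicharMnr.
Qed.

Lemma qij_refl_jp chi p j : j != p ->
  qij (rbichar p chi) j p = (qij chi j p * qij chi p p ^+ ncartan chi p j)^-1.
Proof.
by move=> jp; rewrite /qij rbicharE sigma_alphap sigma_alphaj // bicharNr bicharDl
  bicharMnl.
Qed.

Lemma qnat_eq0 (q : k) n : q != 1 -> q ^+ n = 1 -> qnat q n = 0.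
Proof.
move=> q1 qn; apply/eqP; have := subrX1 q n; rewrite qn subrr => /esym/eqP.
by rewrite mulf_eq0 subr_eq0 (negPf q1).
Qed.

Lemma cartan_min_dual (q Q : k) (M : nat) : q != 0 -> Q != 0 ->
  let P R m := qnat q m.+1 * (q ^+ m * R - 1) == 0 in
  P Q M -> (forall n, P Q n -> (M <= n)%N) ->
  P (Q * q ^+ (M + M))^-1 M /\
  (forall n, P (Q * q ^+ (M + M))^-1 n -> (M <= n)%N).
Proof.
move=> q0 Q0 P PM hM.
have PE R m : P R m = (qnat q m.+1 == 0) || (q ^+ m * R == 1).
  by rewrite /P mulf_eq0 subr_eq0.
have qX n : q ^+ n != 0 by rewrite expf_neq0.
have dualE n : (q ^+ n * (Q * q ^+ (M + M))^-1 == 1) =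
               (q ^+ n == Q * q ^+ (M + M)).
  by rewrite -{1}(divff (mulf_neq0 Q0 (qX (M + M)%N))) (inj_eq (mulIf _)) //
    invr_neq0 // mulf_neq0.
split.
  move: PM; rewrite !PE dualE => /orP[-> //|/eqP h].
  by rewrite exprD mulrA [Q * _]mulrC h mul1r eqxx orbT.
move=> n; rewrite PE dualE leqNgt => h; apply/negP => nM.
have Pn : qnat q n.+1 != 0.
  by apply/negP => h'; have := hM n; rewrite PE h' => /(_ isT); rewrite leqNgt nM.
move: h; rewrite (negPf Pn) /= => /eqP h.
have qM : (q ^+ (M - n) = 1) \/ q ^+ M.+1 = 1.
  move: PM; rewrite PE => /orP[/eqP z|/eqP z].
    by right; apply/eqP; rewrite -subr_eq0 subrX1 -/(qnat q M.+1) z mulr0.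
  left; apply: (mulIf (qX n)); rewrite -exprD subnK ?(ltnW nM) // mul1r.
  by rewrite h exprD mulrA [Q * _]mulrC z mul1r.
case: qM => z.
  have [q1|q1] := eqVneq q 1.
    have := hM 0%N; rewrite PE expr0 mul1r.
    have -> : Q == 1 by move/eqP: h; rewrite q1 !expr1n mulr1 eq_sym.
    by rewrite orbT leqn0 => /(_ isT) /eqP M0; rewrite M0 in nM.
  have := hM (M - n).-1; rewrite PE prednK ?subn_gt0 // (qnat_eq0 q1 z) eqxx.
  by move=> /(_ isT); lia.
have := hM (M - n).-1; rewrite PE.
have -> : q ^+ (M - n).-1 * Q == 1.
  rewrite -(inj_eq (mulIf (qX (M + M)%N))) -mulrA -h mul1r -exprD.
  have -> : (M + M = (M - n).-1 + n + M.+1)%N by lia.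
  by rewrite [X in _ == X]exprD z mulr1.
by rewrite orbT => /(_ isT); lia.
Qed.

Lemma ncartan_refl chi p j : pfinite chi p -> j != p ->
  ncartan (rbichar p chi) p j = ncartan chi p j.
Proof.
move=> fin jp; have [M [e PM hM]] := ominP (fin j jp).
have ne : ncartan chi p j = M by rewrite /ncartan e.
have condE psi m : cartan_cond psi p j m =
    (qnat (qij psi p p) m.+1 *
       (qij psi p p ^+ m * (qij psi p j * qij psi j p) - 1) == 0).
  by rewrite /cartan_cond mulrA.
have [] := @cartan_min_dual (qij chi p p) (qij chi p j * qij chi j p) M.
- exact: bichar_neq0.
- by rewrite mulf_neq0 ?bichar_neq0.
- by rewrite -condE.
- by move=> n; rewrite -condE; exact: hM.
have QE : qij (rbichar p chi) p j * qij (rbichar p chi) j p =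
    (qij chi p j * qij chi j p * qij chi p p ^+ (M + M))^-1.
  by rewrite qij_refl_pj // qij_refl_jp // ne -invfM mulrACA exprD.
move=> P1 P2; rewrite {1}/ncartan (@omin_eq _ M) ?ne //.
  by rewrite condE qij_refl_pp QE.
by move=> n; rewrite condE qij_refl_pp QE; exact: P2.
Qed.

Lemma sigma_refl chi p : pfinite chi p -> sigma (rbichar p chi) p =1 sigma chi p.
Proof.
move=> fin a; rewrite /sigma; congr (_ - _ *~ _).
apply: eq_bigr => j _; rewrite /cartan; case: eqP => // /eqP jp.
by rewrite ncartan_refl.
Qed.

Lemma rbicharK chi p : pfinite chi p -> rbichar p (rbichar p chi) = chi.
Proof.
move=> fin; apply: bichar_ext => a b.
by rewrite !rbicharE !sigma_refl // !sigmaK.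
Qed.

Lemma pfinite_border chi p (b : nat) : border chi (alpha p) = Some b -> pfinite chi p.
Proof.
move=> /ominSP[/andP[b0 hb] _] j _; exists b.-1.
by rewrite /cartan_cond prednK // (eqP hb) mul0r.
Qed.

End ReflectionInvolutive.

Section Omega.
Variables (k : fieldType) (I : finType) (chi : bichar k I).
Local Notation F := (freealg k (gen I)).
Local Notation X := (@fgen k (gen I)).
Local Notation q := (qij chi).
Local Notation A := (calU chi).
Local Notation x_ := (calUgen chi).
Local Notation pr := (calUproj chi).

Lemma calU_torus s t : is_torus s -> is_torus t -> x_ s * x_ t = x_ t * x_ s.
Proof.
move=> hs ht; apply/eqP; rewrite -subr_eq0 /calUgen -!(rmorphM pr) -rmorphB.
by apply/eqP/calU_rel0; exact: rel_torus.
Qed.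

Lemma calU_KV i : x_ (gK i) * x_ (gKV i) = 1.
Proof.
apply/eqP; rewrite -subr_eq0 /calUgen -(rmorphM pr) -(rmorph1 pr) -rmorphB.
by apply/eqP/calU_rel0; exact: rel_KV.
Qed.

Lemma calU_LV i : x_ (gL i) * x_ (gLV i) = 1.
Proof.
apply/eqP; rewrite -subr_eq0 /calUgen -(rmorphM pr) -(rmorph1 pr) -rmorphB.
by apply/eqP/calU_rel0; exact: rel_LV.
Qed.

Lemma calU_conj s t g c : calU_rel chi (X s * X g * X t - c *: X g) ->
  x_ s * x_ g * x_ t = c *: x_ g.
Proof.
move=> h; apply/eqP; rewrite -subr_eq0 /calUgen -!(rmorphM pr) -linearZZ.
by rewrite -rmorphB; apply/eqP/calU_rel0.
Qed.

Lemma calU_EF i j : x_ (gE i) * x_ (gF j) - x_ (gF j) * x_ (gE i) =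
  (i == j)%:R *: (x_ (gK i) - x_ (gL i)).
Proof.
apply/eqP; rewrite -subr_eq0 /calUgen -!(rmorphM pr) -!rmorphB -linearZZ.
by rewrite -rmorphB; apply/eqP/calU_rel0; exact: rel_EF.
Qed.

Lemma calU_conjV (s t y : A) (c : k) : c != 0 -> s * t = 1 -> t * s = 1 ->
  s * y * t = c^-1 *: y -> t * y * s = c *: y.
Proof.
move=> c0 st ts h.
have {1}-> : y = c *: (s * y * t) by rewrite h scalerA mulfV ?scale1r.
by rewrite -scalerAr -scalerAl !mulrA ts mul1r -mulrA ts mulr1.
Qed.

Lemma mulrcE (a b : A^c) : a * b = (b : A) * (a : A).
Proof. by []. Qed.

Definition scalarc (c : k) : A^c := c%:A.

Lemma scalarc_is_zmod_morphism : zmod_morphism scalarc.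
Proof. by move=> a b; exact: scalerBl. Qed.
Lemma scalarc_is_monoid_morphism : monoid_morphism scalarc.
Proof.
split=> [|a b]; first exact: scale1r.
by rewrite mulrcE /scalarc -scalerAl mul1r scalerA mulrC.
Qed.
HB.instance Definition _ :=
  GRing.isZmodMorphism.Build k A^c scalarc scalarc_is_zmod_morphism.
HB.instance Definition _ :=
  GRing.isMonoidMorphism.Build k A^c scalarc scalarc_is_monoid_morphism.

Lemma scalarc_comm (c : k) (x : A^c) : GRing.comm (scalarc c) x.
Proof.
by rewrite /GRing.comm !mulrcE /scalarc -scalerAr mulr1 -scalerAl mul1r.
Qed.

Definition Omega0 : F -> A^c :=
  feval scalarc_comm (fun g => x_ (swapEF g) : A^c).
HB.instance Definition _ := GRing.RMorphism.on Omega0.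

Lemma Omega0Z c y : Omega0 (c *: y) = c *: (Omega0 y : A).
Proof. by rewrite /Omega0 feval_scale mulrcE /scalarc -scalerAr mulr1. Qed.

Lemma Omega0_rel x : calU_rel chi x -> Omega0 x = 0.
Proof.
have e g : Omega0 (X g) = x_ (swapEF g) by exact: feval_gen.
have s := Omega0Z.
have m (y z : F) : Omega0 (y * z) = (Omega0 z : A) * (Omega0 y : A).
  by rewrite rmorphM mulrcE.
have b (y z : F) : Omega0 (y - z) = (Omega0 y : A) - (Omega0 z : A).
  by rewrite rmorphB.
have o : Omega0 1 = 1 :> A by rewrite rmorph1.
have KVK i : x_ (gKV i) * x_ (gK i) = 1 by rewrite calU_torus // calU_KV.
have LVL i : x_ (gLV i) * x_ (gL i) = 1 by rewrite calU_torus // calU_LV.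
case=> [g t hg ht|i|i|i j|i j|i j|i j|i j]; rewrite !(b, m, s, o) !e /=.
- have sw u : is_torus u -> swapEF u = u by case: u.
  by rewrite !sw // calU_torus // subrr.
- by rewrite KVK subrr.
- by rewrite LVL subrr.
- by rewrite mulrA (@calU_conjV _ _ _ (q i j)) ?subrr ?bichar_neq0 ?calU_KV ?KVK //;
    exact/calU_conj/rel_KF.
- rewrite mulrA (@calU_conjV _ _ _ (q j i)^-1) ?subrr ?invr_neq0 ?bichar_neq0 //
    ?calU_LV ?LVL // invrK.
  exact/calU_conj/rel_LF.
- rewrite mulrA (@calU_conjV _ _ _ (q i j)^-1) ?subrr ?invr_neq0 ?bichar_neq0 //
    ?calU_KV ?KVK // invrK.
  exact/calU_conj/rel_KE.
- by rewrite mulrA (@calU_conjV _ _ _ (q j i)) ?subrr ?bichar_neq0 ?calU_LV ?LVL //;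
    exact/calU_conj/rel_LE.
- by rewrite calU_EF eq_sym; case: eqP => [->|_]; rewrite ?scale0r ?subrr.
Qed.

(* the antiautomorphism Omega, as an algebra map to the converse algebra *)
Definition Omega : A -> A^c :=
  calUlift Omega0_rel.
HB.instance Definition _ := GRing.RMorphism.on Omega.

Lemma Omega_gen g : Omega (x_ g) = x_ (swapEF g).
Proof. by rewrite /Omega calUliftE; exact: feval_gen. Qed.

Lemma OmegaZ c (x : A) : Omega (c *: x) = c *: (Omega x : A).
Proof.
have [y ->] := calUprojP x; rewrite -linearZZ /Omega !calUliftE.
exact: Omega0Z.
Qed.

Lemma OmegaM (x y : A) : Omega (x * y) = (Omega y : A) * (Omega x : A).
Proof. by rewrite rmorphM mulrcE. Qed.

Lemma eps_Omega (x : A) : eps (Omega x : A) = eps x.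
Proof.
pose f (y : F) : k := eps (Omega (pr y) : A).
have fz : zmod_morphism f by move=> y z; rewrite /f !rmorphB.
have fm : monoid_morphism f.
  split=> [|y z]; first by rewrite /f !rmorph1.
  by rewrite /f (rmorphM pr) OmegaM (rmorphM (@eps k I chi)) mulrC.
pose fM := GRing.isMonoidMorphism.Build F k f fm.
pose fA := GRing.isZmodMorphism.Build F k f fz.
pose f' : {rmorphism F -> k} := HB.pack f fM fA.
have [y ->] := calUprojP x.
rewrite -[LHS]/(f' y) /eps calUliftE.
apply: freealg_ext => [c|g].
  rewrite -[LHS]/(f _) /f /= linearZZ OmegaZ epsZ !rmorph1 mulr1.
  by rewrite [RHS]feval_scale rmorph1 mulr1.
rewrite -[LHS]/(f _) /f -/(calUgen chi g) Omega_gen eps_gen [RHS]feval_gen.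
by case: g.
Qed.

End Omega.

Section NicholsIdeal.
Variables (k : fieldType) (I : finType) (chi : bichar k I).
Local Notation A := (calU chi).
Local Notation x_ := (calUgen chi).

(* the subalgebra calU^+(chi) *)
Definition calUplus : A -> Prop := in_subalg (fun x => exists i, x = x_ (gE i)).

(* the graph y = partial^K_i(x) of the map partial^K_i : calU^+ -> calU^+,
   where z = partial^L_i(x); by the triangular decomposition of calU(chi), the
   pair (y, z) exists and is unique *)
Definition partialK (i : I) (x y : A) : Prop :=
  [/\ calUplus x, calUplus y & exists z, calUplus z /\
    x * x_ (gF i) - x_ (gF i) * x = y * x_ (gK i) - x_ (gL i) * z].

Record admissible (J : A -> Prop) : Prop := Admissible {
  adm_sub : forall x, J x -> calUplus x;
  adm0 : J 0;
  admD : forall x y, J x -> J y -> J (x + y);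
  admMl : forall a x, calUplus a -> J x -> J (a * x);
  admMr : forall a x, calUplus a -> J x -> J (x * a);
  adm_eps : forall x, J x -> eps x = 0;
  adm_partial : forall i x, J x -> exists2 y, partialK i x y & J y }.

(* The union of all admissible ideals; since the sum of two of them is
   admissible, it is the largest one, see [Iplus_admissible]. *)
Definition Iplus (x : A) : Prop := exists2 J, admissible J & J x.

Definition Iminus (y : A) : Prop := exists2 x, Iplus x & y = Omega x.

Lemma Iplus_max J : admissible J -> forall x, J x -> Iplus x.
Proof. by move=> hJ x Jx; exists J. Qed.

Lemma partialKD i x x' y y' : partialK i x y -> partialK i x' y' ->
  partialK i (x + x') (y + y').
Proof.
move=> [hx hy [z [hz e]]] [hx' hy' [z' [hz' e']]].
split; [exact: in_subalgD|exact: in_subalgD|exists (z + z'); split].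
  exact: in_subalgD.
by rewrite !(mulrDl, mulrDr) !opprD addrACA e e' addrACA.
Qed.

Lemma Iplus_admissible : admissible Iplus.
Proof.
have sumP J1 J2 : admissible J1 -> admissible J2 ->
    admissible (fun z => exists x y, [/\ J1 x, J2 y & z = x + y]).
  move=> h1 h2; split.
  - move=> _ [x [y [hx hy ->]]]; apply: in_subalgD.
      exact: (adm_sub h1). exact: (adm_sub h2).
  - exists 0, 0; rewrite addr0; split=> //; [exact: adm0 h1|exact: adm0 h2].
  - move=> _ _ [x [y [hx hy ->]]] [x' [y' [hx' hy' ->]]].
    exists (x + x'), (y + y'); rewrite addrACA; split=> //.
      exact: admD h1 _ _ _ _. exact: admD h2 _ _ _ _.
  - move=> a _ ha [x [y [hx hy ->]]]; exists (a * x), (a * y); rewrite mulrDr.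
    by split=> //; [exact: admMl h1 _ _ _ _|exact: admMl h2 _ _ _ _].
  - move=> a _ ha [x [y [hx hy ->]]]; exists (x * a), (y * a); rewrite mulrDl.
    by split=> //; [exact: admMr h1 _ _ _ _|exact: admMr h2 _ _ _ _].
  - move=> _ [x [y [hx hy ->]]].
    by rewrite rmorphD /= (adm_eps h1) // (adm_eps h2) // addr0.
  - move=> i _ [x [y [hx hy ->]]].
    have [x' px hx'] := adm_partial h1 i hx.
    have [y' py hy'] := adm_partial h2 i hy.
    by exists (x' + y'); [exact: partialKD|exists x', y'].
split.
- by move=> x [J hJ Jx]; exact: adm_sub hJ _ Jx.
- exists (eq 0) => //; split.
  + by move=> _ <-; rewrite -(scale0r 1); exact: in_subalgC.
  + by [].
  + by move=> _ _ <- <-; rewrite addr0.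
  + by move=> a _ _ <-; rewrite mulr0.
  + by move=> a _ _ <-; rewrite mul0r.
  + by move=> _ <-; rewrite rmorph0.
  + move=> i _ <-; exists 0 => //.
    have h0 : calUplus 0 by rewrite -(scale0r 1); exact: in_subalgC.
    by split=> //; exists 0; rewrite !(mulr0, mul0r).
- move=> x y [J hJ Jx] [J' hJ' Jy].
  exists (fun z => exists x y, [/\ J x, J' y & z = x + y]); first exact: sumP.
  by exists x, y.
- by move=> a x ha [J hJ Jx]; exists J => //; exact: admMl hJ _ _ _ _.
- by move=> a x ha [J hJ Jx]; exists J => //; exact: admMr hJ _ _ _ _.
- by move=> x [J hJ Jx]; exact: adm_eps hJ _ Jx.
- move=> i x [J hJ Jx]; have [y py Jy] := adm_partial hJ i Jx.
  by exists y => //; exists J.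
Qed.

Definition Iplusminus (x : A) : Prop := Iplus x \/ Iminus x.

Lemma Iplusminus_eps x : Iplusminus x -> eps x = 0.
Proof.
case=> [[J hJ Jx]|[y [J hJ Jy] ->]]; first exact: adm_eps hJ _ Jx.
by rewrite eps_Omega; exact: adm_eps hJ _ Jy.
Qed.

End NicholsIdeal.

HB.lock Definition U_ideal (k : fieldType) (I : finType) (chi : bichar k I)
  : ideal (calU chi) := gen_ideal (@Iplusminus_eps k I chi).

Section QuotientU.
Variables (k : fieldType) (I : finType) (chi : bichar k I).

Definition U := quotalg (U_ideal chi).
HB.instance Definition _ := GRing.Algebra.on U.

Definition Uproj : calU chi -> U := aproj (U_ideal chi).
HB.instance Definition _ := GRing.LRMorphism.on Uproj.

Definition Ugen (g : gen I) : U := Uproj (calUgen chi g).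

End QuotientU.

Section LusztigMaps.
Variables (k : fieldType) (I : finType).
Implicit Types chi : bichar k I.

Section RootVectors.
Variables (chi : bichar k I) (p i : I) (m : nat).
Local Notation x_ := (Ugen chi).

Definition adstep (e t tV y : U chi) : U chi := e * y - t * y * tV * e.

Definition Eplus : U chi :=
  iter m (adstep (x_ (gE p)) (x_ (gK p)) (x_ (gKV p))) (x_ (gE i)).
Definition Eminus : U chi :=
  iter m (adstep (x_ (gE p)) (x_ (gL p)) (x_ (gLV p))) (x_ (gE i)).
Definition Fplus : U chi :=
  iter m (adstep (x_ (gF p)) (x_ (gL p)) (x_ (gLV p))) (x_ (gF i)).
Definition Fminus : U chi :=
  iter m (adstep (x_ (gF p)) (x_ (gK p)) (x_ (gKV p))) (x_ (gF i)).
End RootVectors.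

(* T_p and T_p^- from U(chi) to U(chi'), where chi' is propositionally equal to
   r_p(chi).  It is a separate parameter because r_p(r_p(chi)) = chi
   ([rbicharK]) is not a conversion.  Here m i = - c^chi_pi. *)
Section Defs.
Variables (p : I) (chi chi' : bichar k I).
Local Notation s := (Ugen chi).
Local Notation t := (Ugen chi').
Local Notation m := (ncartan chi p).

Definition lusztig_torus (T : U chi -> U chi') : Prop :=
  [/\ T (s (gK p)) = t (gKV p),
      T (s (gL p)) = t (gLV p),
      forall i, i != p -> T (s (gK i)) = t (gK i) * t (gK p) ^+ m i &
      forall i, i != p -> T (s (gL i)) = t (gL i) * t (gL p) ^+ m i].

Record lusztig (T : {lrmorphism U chi -> U chi'}) : Prop := {
  lusztig_bij : bijective T;
  lusztig_KL : lusztig_torus T;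
  lusztig_Ep : T (s (gE p)) = t (gF p) * t (gLV p);
  lusztig_Fp : T (s (gF p)) = t (gKV p) * t (gE p);
  lusztig_E : forall i, i != p -> T (s (gE i)) = Eplus chi' p i (m i);
  lusztig_F : forall i, i != p ->
    T (s (gF i)) = (lambda (rbichar p chi) p i)^-1 *: Fplus chi' p i (m i) }.

Record lusztigV (T : {lrmorphism U chi -> U chi'}) : Prop := {
  lusztigV_bij : bijective T;
  lusztigV_KL : lusztig_torus T;
  lusztigV_Ep : T (s (gE p)) = t (gKV p) * t (gF p);
  lusztigV_Fp : T (s (gF p)) = t (gE p) * t (gLV p);
  lusztigV_E : forall i, i != p ->
    T (s (gE i)) =
      (lambda (rbichar p (bicharV chi)) p i)^-1 *: Eminus chi' p i (m i);
  lusztigV_F : forall i, i != p ->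
    T (s (gF i)) = (-1) ^+ m i *: Fminus chi' p i (m i) }.

End Defs.
End LusztigMaps.

(* the vector space with basis X, and the linear extension of f : X -> W *)
HB.lock Definition fbasis (K : fieldType) (X : choiceType) (x : X) : {malg K[X]} :=
  << x >>.
HB.lock Definition flift (K : fieldType) (X : choiceType) (W : lmodType K)
  (f : X -> W) (g : {malg K[X]}) : W := \sum_(x <- msupp g) g@_x *: f x.

Section FreeModule.
Variables (K : fieldType) (X : choiceType) (W : lmodType K) (f : X -> W).
Local Notation flift := (flift f).

Lemma fliftw (d : {fset X}) g : (msupp g `<=` d)%fset ->
  flift g = \sum_(x <- d) g@_x *: f x.
Proof.
move=> le; rewrite flift.unlock [LHS](big_fset_incl _ le) => //= x _ /mcoeff_outdom ->.
by rewrite scale0r.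
Qed.

Lemma flift_is_linear : linear flift.
Proof.
move=> a g h.
have gE := @fliftw (msupp g `|` msupp h)%fset g (fsubsetUl _ _).
have hE := @fliftw (msupp g `|` msupp h)%fset h (fsubsetUr _ _).
rewrite (@fliftw (msupp g `|` msupp h)%fset); last first.
  by apply: fsubset_trans (msuppD_le _ _) _; apply: fsetSU; exact: msuppZ_le.
rewrite gE hE scaler_sumr -big_split; apply: eq_bigr => x _.
by rewrite mcoeffD mcoeffZ scalerDl scalerA.
Qed.
HB.instance Definition _ :=
  GRing.isLinear.Build K {malg K[X]} W _ flift flift_is_linear.

Lemma fliftU x : flift (fbasis K x) = f x.
Proof. by rewrite fbasis.unlock (fliftw msuppU_le) big_seq_fset1 mcoeffUU scale1r. Qed.

End FreeModule.

Section TorusCharacters.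
Variables (k K : fieldType) (iota : {rmorphism k -> K}) (I : finType).
Implicit Types (a b : lattice I).

(* a character Lambda of U^0, the group algebra of Z^I x Z^I, is given by its
   values [Lambda a b] on the group elements K_a L_b *)
Record tchar := TChar {
  tchar_fun :> lattice I -> lattice I -> K;
  tchar_neq0 : forall a b, tchar_fun a b != 0;
  tcharD : forall a a' b b',
    tchar_fun (a + a') (b + b') = tchar_fun a b * tchar_fun a' b' }.

Section Reflect.
Variables (chi : bichar k I) (p : I) (b : nat) (Lam : tchar).
Local Notation s := (sigma chi p).

Let f x y : K := Lam (s x) (s y) *
  iota (chi (alpha p) (s y) ^+ b.-1 * chi (s x) (alpha p) ^- b.-1).

Fact tp_neq0 x y : f x y != 0.
Proof.
by rewrite mulf_neq0 ?tchar_neq0 // fmorph_eq0 mulf_neq0 ?invr_neq0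
  ?expf_neq0 ?bichar_neq0.
Qed.

Fact tpD x x' y y' : f (x + x') (y + y') = f x y * f x' y'.
Proof.
rewrite /f !raddfD tcharD bicharDl bicharDr mulrACA -rmorphM; congr (_ * iota _).
by rewrite !exprMn invfM mulrACA.
Qed.

(* t_p^chi(Lambda), where b = b^chi(alpha_p); see [tpE] *)
Definition tp : tchar := TChar tp_neq0 tpD.

Lemma tpE x y : tp (s x) (s y) =
  Lam x y * iota (chi (alpha p) y ^+ b.-1 * chi x (alpha p) ^- b.-1).
Proof. by rewrite /= /f !sigmaK. Qed.
End Reflect.

End TorusCharacters.

Section Verma.
Variables (k K : fieldType) (iota : {rmorphism k -> K}) (I : finType).
Variables (chi : bichar k I) (Lam : tchar K I).
Local Notation u_ := (Ugen chi).

Definition zexp (x xV : U chi) (n : int) : U chi :=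
  match n with Posz m => x ^+ m | Negz m => xV ^+ m.+1 end.

Definition Kexp (a : lattice I) : U chi :=
  \prod_i zexp (u_ (gK i)) (u_ (gKV i)) (a i).
Definition Lexp (a : lattice I) : U chi :=
  \prod_i zexp (u_ (gL i)) (u_ (gLV i)) (a i).

(* The tensor product of U(chi) with K_Lambda = K over the subalgebra
   U^+(chi) U^0, as a K-vector space: the free K-vector space on
   the pairs (x, c) modulo the relations of the tensor product.  The
   element K_a L_b E of U^+ U^0 acts on K_Lambda by
   Lambda(K_a L_b) eps(E), and these elements spanned U^+ U^0. *)
Local Notation ten0 x c := (fbasis K (x, c)).

Inductive tensor_rel : {malg K[(U chi * K)%type]} -> Prop :=
| tens_addl x y c : tensor_rel (ten0 (x + y) c - (ten0 x c + ten0 y c))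
| tens_addr x c d : tensor_rel (ten0 x (c + d) - (ten0 x c + ten0 x d))
| tens_scale e x c : tensor_rel (ten0 x (e * c) - e *: ten0 x c)
| tens_bal x a b E c : calUplus E ->
    tensor_rel (ten0 (x * (Kexp a * Lexp b * Uproj E)) c
                - ten0 x (Lam a b * iota (eps E) * c)).

Definition verma := quotmod (spanned tensor_rel).
HB.instance Definition _ := GRing.Lmodule.on verma.

Definition tensor (x : U chi) (c : K) : verma := 
  qproj (spanned tensor_rel) (fbasis K (x, c)).

Lemma tensorDl x y c : tensor (x + y) c = tensor x c + tensor y c.
Proof. rewrite /tensor -!linearD; apply/qproj_eq/in_spanS; exact: tens_addl. Qed.
Lemma tensorDr x c d : tensor x (c + d) = tensor x c + tensor x d.
Proof. rewrite /tensor -!linearD; apply/qproj_eq/in_spanS; exact: tens_addr. Qed.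
Lemma tensorZ e x c : tensor x (e * c) = e *: tensor x c.
Proof. rewrite /tensor -!linearZZ; apply/qproj_eq/in_spanS; exact: tens_scale. Qed.
Lemma tensor_bal x a b E c : calUplus E ->
  tensor (x * (Kexp a * Lexp b * Uproj E)) c =
  tensor x (Lam a b * iota (eps E) * c).
Proof. by move=> hE; apply/qproj_eq/in_spanS; exact: tens_bal. Qed.

(* the left action of U(chi): u (x (x) c) = (u x) (x) c *)
Section Action.
Variable u : U chi.

Definition vact0 : {malg K[(U chi * K)%type]} -> verma :=
  flift (fun z => tensor (u * z.1) z.2).
HB.instance Definition _ := GRing.Linear.on vact0.

Lemma vact0_rel z : spanned tensor_rel z -> vact0 z = 0.
Proof.
have B : {morph vact0 : x y / x - y} := linearB vact0.
have D : {morph vact0 : x y / x + y} := linearD vact0.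
have Z a x : vact0 (a *: x) = a *: vact0 x by exact: linearZZ.
have e x c : vact0 (fbasis K (x, c)) = tensor (u * x) c by exact: fliftU.
elim=> {z} [|z|x y _ hx _ hy|a x _ hx].
- exact: linear0.
- case=> [x y c|x c d|f x c|x a b E c hE]; rewrite B ?D ?Z !e.
  + by rewrite mulrDr tensorDl subrr.
  + by rewrite tensorDr subrr.
  + by rewrite tensorZ subrr.
  + by rewrite mulrA tensor_bal // subrr.
- by rewrite D hx hy addr0.
- by rewrite Z hx scaler0.
Qed.

Definition vact : verma -> verma := qlift vact0_rel.
HB.instance Definition _ := GRing.Linear.on vact.

Lemma vactE x c : vact (tensor x c) = tensor (u * x) c.
Proof. by rewrite /vact /tensor qliftE; exact: fliftU. Qed.

End Action.

Definition vLam : verma := tensor 1 1.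

End Verma.

(* Main.v *)
Require Import Defs.
From mathcomp Require Import all_boot all_order all_algebra ring zify.
From mathcomp Require Import monalg.
Import GRing.Theory.
Local Open Scope ring_scope.
Set Implicit Arguments.
Unset Strict Implicit.
Unset Printing Implicit Defensive.

(** Write v and v' for the generators of M^chi(Lambda) and of
    M^(r_p chi)(t_p Lambda), and q for chi(alpha_p, alpha_p), so that (b)_q = 0 and
    q^b = 1.  The argument is the same for T_p and T_p^-; call either of them T.

    Surjectivity.  The image contains T(u) F_p^(b-1) v for all u, that is, the
    submodule generated by F_p^(b-1) v because T is onto.  In a Verma module
    E_p F_p^n v = (n)_q (q^(1-n) Lambda(K_p) - Lambda(L_p)) F_p^(n-1) v
    ([vact_EFX]); for 0 < n < b the factor (n)_q is nonzero by the minimality of b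
    and the other one by the assumption on Lambda.  Hence E_p^(b-1) F_p^(b-1) v is
    a nonzero multiple of v.

    Injectivity.  There is a map back, u v |-> T^-1(u) F_p^(b-1) v'
    ([back_map]).  It is well defined if T^-1(x) acts on F_p^(b-1) v' as x acts on
    v, for x in the torus and for x = E_i.
    - For the torus this is the purpose of the twist in t_p(Lambda).
    - T^-1(E_p) is F_p times a torus element, up to order and a scalar, and
      F_p^b = 0 in U(r_p chi): the skew derivatives of E_p^b are multiples of
      (b)_q, so E_p^b generates an ideal of U^+ inside the maximal one
      ([powideal_admissible], [U_FX0]).
    - For i <> p, T^-1(E_i) is a nonzero multiple of the root vector E^-_(i,m) for
      T_p and of E^+_(i,m) for T_p^-: since T(E_p) is essentially F_p, applying T
      to a q-commutator with E_p produces a commutator with F_p, which lowers the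
      root vector T(E_i) by one step ([adstep_commutator], [adstep_descent]).
      Such a vector kills F_p^n v' for all n, as it is a combination of products
      of E_p, E_i and torus elements, and E_i kills the string F_p^n v'.
    Finally T^-1(F_p) is E_p times a torus element, so the composite of the given
    map with the map back multiplies by the factor that comes from
    E_p^(b-1) F_p^(b-1) v'.  It is nonzero because t_p(Lambda) satisfies the same
    genericity assumption as Lambda ([reflected_generic]). *)

(** * Quantum integers *)

Section QNumbers.
Variable k : fieldType.
Implicit Type q : k.

Lemma qnat0 q : qnat q 0 = 0.
Proof. by rewrite /qnat big_ord0. Qed.

Lemma qnatS q n : qnat q n.+1 = qnat q n + q ^+ n.
Proof. by rewrite /qnat big_ord_recr. Qed.

Lemma qnatSl q n : qnat q n.+1 = 1 + q * qnat q n.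
Proof.
rewrite /qnat big_ord_recl expr0 mulr_sumr; congr (_ + _).
by apply: eq_bigr => i _; rewrite exprS.
Qed.

Lemma qnatV q n : q != 0 -> qnat q^-1 n.+1 = q ^- n * qnat q n.+1.
Proof.
move=> q0; elim: n => [|n ih]; first by rewrite !qnatS !qnat0 !expr0 invr1 mul1r.
rewrite qnatS ih [qnat q n.+2]qnatSl mulrDr mulr1 mulrA addrC exprVn; congr (_ + _ * _).
by rewrite exprS invfM mulrAC mulVf ?mul1r.
Qed.

Lemma expr_qnat0 q n : qnat q n = 0 -> q ^+ n = 1.
Proof. by move=> z; apply/eqP; rewrite -subr_eq0 subrX1 -/(qnat q n) z mulr0. Qed.

End QNumbers.

(** * Iterated q-commutators *)

Section RootVectorCommutators.
Variables (k : fieldType) (A : algType k).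
Variables (q a : k) (e t tV y : A).
(* The step unfolds [adstep]; here it is written for an arbitrary algebra.
   The data (t, s, f) stand for (K_p, L_p, F_p) when E^+ is meant, and for
   (L_p, K_p, - F_p), with q_pp, q_pi, q_ip replaced by q_pp^-1, q_ip^-1,
   q_pi^-1, when E^- is meant. *)
Local Notation y_ n := (iter n (fun z => e * z - t * z * tV * e) y).

Hypothesis ttV : t * tV = 1.
Hypothesis te : t * e = q *: (e * t).
Hypothesis ty : t * y = a *: (y * t).

Lemma adstep_weight_next n :
  t * y_ n = (q ^+ n * a) *: (y_ n * t) ->
  y_ n.+1 = e * y_ n - (q ^+ n * a) *: (y_ n * e).
Proof. by move=> h; rewrite iterS h -!scalerAl -[_ * t * tV]mulrA ttV mulr1. Qed.

Lemma adstep_weight n : t * y_ n = (q ^+ n * a) *: (y_ n * t).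
Proof.
elim: n => [|n ih]; first by rewrite expr0 mul1r.
rewrite (adstep_weight_next ih); set z := y_ n in ih *.
have h1 : t * (e * z) = (q ^+ n.+1 * a) *: (e * z * t).
  by rewrite mulrA te -scalerAl -(mulrA e t) ih -scalerAr scalerA exprS -!mulrA; congr (_ *: _); ring.
have h2 : t * (z * e) = (q ^+ n.+1 * a) *: (z * e * t).
  by rewrite mulrA ih -scalerAl -(mulrA z t) te -scalerAr scalerA exprS -!mulrA; congr (_ *: _); ring.
by rewrite mulrBr mulrBl h1 -scalerAr h2 -scalerAl scalerBr !scalerA; congr (_ - _ *: _); ring.
Qed.

Lemma adstepE n : y_ n.+1 = e * y_ n - (q ^+ n * a) *: (y_ n * e).
Proof. exact/adstep_weight_next/adstep_weight. Qed.

Variables (b : k) (f s : A).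
Hypothesis es : e * s = q *: (s * e).
Hypothesis ys : y * s = b *: (s * y).
Hypothesis ef : e * f - f * e = t - s.
Hypothesis yf : y * f = f * y.

Lemma adstep_coweight n : y_ n * s = (q ^+ n * b) *: (s * y_ n).
Proof.
elim: n => [|n ih]; first by rewrite expr0 mul1r.
rewrite adstepE; set z := y_ n in ih *.
have h1 : e * z * s = (q ^+ n.+1 * b) *: (s * (e * z)).
  by rewrite -(mulrA e z s) ih -scalerAr (mulrA e s) es -scalerAl scalerA exprS -!mulrA; congr (_ *: _); ring.
have h2 : z * e * s = (q ^+ n.+1 * b) *: (s * (z * e)).
  by rewrite -(mulrA z e s) es -scalerAr (mulrA z s) ih -scalerAl scalerA exprS -!mulrA; congr (_ *: _); ring.
by rewrite mulrBl mulrBr h1 -scalerAl h2 -scalerAr scalerBr !scalerA; congr (_ - _ *: _); ring.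
Qed.

Definition adcoef n : k := qnat q n * (q ^+ n.-1 * (a * b) - 1).

(** Commuting f past a q-commutator lowers its length: by induction the coefficient
   g_n satisfies g_(n+1) = q g_n + q^(2n) a b - 1, because in (t - s) y_n the
   term with t cancels against the second half of the q-commutator.  For
   the root vectors, the closed form [adcoef] at n + 1 vanishes if and only if n
   satisfies the condition whose least solution is minus the Cartan entry. *)
Lemma adstep_commutator n :
  y_ n.+1 * f - f * y_ n.+1 = adcoef n.+1 *: (s * y_ n).
Proof.
pose g n := y_ n * f - f * y_ n.
have gS m : g m.+1 = (e * g m - (q ^+ m * a) *: (g m * e)) +
    (q ^+ (m + m) * (a * b) - 1) *: (s * y_ m).
  rewrite /g adstepE; set z := y_ m.
  have tz : t * z = (q ^+ m * a) *: (z * t) by exact: adstep_weight.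
  have zs : z * s = (q ^+ m * b) *: (s * z) by exact: adstep_coweight.
  have -> : (q ^+ (m + m) * (a * b) - 1) *: (s * z) =
     (e * f - f * e) * z - (q ^+ m * a) *: (z * (e * f - f * e)).
    rewrite ef mulrBl mulrBr tz zs scalerBr !scalerA scalerBl scale1r.
    rewrite opprB addrACA addrC addrA subrK addrC; congr (_ *: _ - _).
    by rewrite exprD; ring.
  rewrite !(mulrBl, mulrBr, scalerBr) -scalerAl -scalerAr !mulrA !opprB.
  by rewrite [in RHS]addrACA !subrKA [LHS]addrACA [RHS]addrACA [- _ - _]addrC.
rewrite -/(g n.+1); elim: n => [|n ih].
  rewrite gS /g /= yf subrr mulr0 mul0r scaler0 subrr add0r /adcoef.
  by rewrite qnatS qnat0 expr0 add0r !mul1r.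
rewrite gS ih -scalerAr -scalerAl (mulrA e s) es -scalerAl.
have -> : adcoef n.+1 *: (q *: (s * e * y_ n)) -
    (q ^+ n.+1 * a) *: (adcoef n.+1 *: (s * y_ n * e)) =
    (q * adcoef n.+1) *: (s * y_ n.+1).
  rewrite [in RHS]adstepE mulrBr -scalerAr !mulrA scalerBr !scalerA exprS.
  by congr (_ *: _ - _ *: _); rewrite /adcoef; ring.
rewrite -scalerDl; congr (_ *: _); rewrite /adcoef [qnat q n.+2]qnatSl.
have := subrX1 q n.+1; rewrite -/(qnat q n.+1) => e1.
have -> : q ^+ (n.+1 + n.+1) = q ^+ n.+1 * (1 + (q - 1) * qnat q n.+1).
  by rewrite -e1 exprD addrCA subrr addr0.
by rewrite /= !exprS; ring.
Qed.

Variables (B : algType k) (T : {lrmorphism B -> A}) (sV : A).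
Variables (e' s' sV' y' : B) (c d : k) (m : nat).
Hypothesis ssV : s * sV = 1.
Hypothesis sVs : sV * s = 1.
Hypothesis Te : T e' = c *: (sV * f).
Hypothesis Ts : T s' = sV.
Hypothesis TsV : T sV' = s.
Hypothesis Ty : T y' = d *: y_ m.
Hypothesis c0 : c != 0.
Hypothesis d0 : d != 0.
Hypothesis ad0 : forall n, (n < m)%N -> adcoef n.+1 != 0.

(** A map T that sends e' to a multiple of s^-1 f and s' to s^-1 turns the
   q-commutator with e' into a commutator with f, so each step taken on the
   source side undoes one step on the target side.  Starting from the m-th
   iterate, m steps lead back to y; this computes the inverse image of E_i under
   the Lusztig isomorphisms. *)
Lemma adstep_descent :
  exists2 x, x != 0 & T (iter m (fun z => e' * z - s' * z * sV' * e') y') = x *: y.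
Proof.
(* After n steps m - n of the steps on the target side remain. *)
have main n : (n <= m)%N -> exists2 x, x != 0 &
    T (iter n (fun z => e' * z - s' * z * sV' * e') y') = x *: y_ (m - n).
  elim: n => [_|n ih nm]; first by exists d; rewrite ?subn0.
  have [x x0 Tx] := ih (ltnW nm).
  have mn : (m - n = (m - n.+1).+1)%N by rewrite subnSK.
  exists (- (x * c * adcoef (m - n))).
    by rewrite oppr_eq0 mn (mulf_neq0 (mulf_neq0 x0 c0)) ?ad0 -?mn ?leq_subr.
  rewrite iterS rmorphB !rmorphM /= Te Ts TsV Tx mn; set z := y_ _.+1.
  have -> : sV * (x *: z) * s * (c *: (sV * f)) = (x * c) *: (sV * (z * f)).
    rewrite -!scalerAr -!scalerAl scalerA mulrC !mulrA; congr (_ *: (_ * _)).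
    by rewrite -!mulrA ssV mulr1.
  have -> : c *: (sV * f) * (x *: z) = (x * c) *: (sV * (f * z)).
    by rewrite -scalerAr -scalerAl scalerA mulrA.
  rewrite -scalerBr -mulrBr -[f * z - _]opprB adstep_commutator.
  by rewrite mulrN -scalerAr mulrA sVs mul1r scalerN scalerA scaleNr.
by have [x x0] := main m (leqnn m); rewrite subnn; exists x.
Qed.

End RootVectorCommutators.

(** * Nilpotency of the generator F_p *)

Section CalURelations.
Variables (k : fieldType) (I : finType) (chi : bichar k I).
Local Notation x_ := (calUgen chi).
Local Notation q := (qij chi).

Lemma calU_VK i : x_ (gKV i) * x_ (gK i) = 1.
Proof. by rewrite calU_torus ?calU_KV. Qed.

Lemma calU_VL i : x_ (gLV i) * x_ (gL i) = 1.
Proof. by rewrite calU_torus ?calU_LV. Qed.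

Lemma calU_conj_comm (s t y : calU chi) c : t * s = 1 ->
  s * y * t = c *: y -> s * y = c *: (y * s).
Proof. by move=> ts h; rewrite scalerAl -h -!mulrA ts mulr1. Qed.

Lemma calU_KE i j : x_ (gK i) * x_ (gE j) = q i j *: (x_ (gE j) * x_ (gK i)).
Proof. exact/(calU_conj_comm (calU_VK i))/calU_conj/rel_KE. Qed.

Lemma calU_LE i j :
  x_ (gL i) * x_ (gE j) = (q j i)^-1 *: (x_ (gE j) * x_ (gL i)).
Proof. exact/(calU_conj_comm (calU_VL i))/calU_conj/rel_LE. Qed.

Lemma calU_KF i j :
  x_ (gK i) * x_ (gF j) = (q i j)^-1 *: (x_ (gF j) * x_ (gK i)).
Proof. exact/(calU_conj_comm (calU_VK i))/calU_conj/rel_KF. Qed.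

Lemma calU_LF i j : x_ (gL i) * x_ (gF j) = q j i *: (x_ (gF j) * x_ (gL i)).
Proof. exact/(calU_conj_comm (calU_VL i))/calU_conj/rel_LF. Qed.

Lemma calU_KX i j n :
  x_ (gK i) * x_ (gE j) ^+ n = q i j ^+ n *: (x_ (gE j) ^+ n * x_ (gK i)).
Proof.
elim: n => [|n ih]; first by rewrite !expr0 scale1r mulr1 mul1r.
rewrite !exprS mulrA calU_KE -scalerAl -(mulrA _ (x_ (gK i))) ih -scalerAr scalerA.
by rewrite !mulrA.
Qed.

Lemma calU_LX i j n :
  x_ (gL i) * x_ (gE j) ^+ n = (q j i) ^- n *: (x_ (gE j) ^+ n * x_ (gL i)).
Proof.
elim: n => [|n ih]; first by rewrite !expr0 invr1 scale1r mulr1 mul1r.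
rewrite !exprS mulrA calU_LE -scalerAl -(mulrA _ (x_ (gL i))) ih -scalerAr scalerA.
by rewrite invfM !mulrA.
Qed.

(** Both coefficients vanish when (n+1)_q = 0 for q = q_ii, so that then the skew
   derivatives of E_i^(n+1) are zero. *)
Lemma calU_EXF i n : x_ (gE i) ^+ n.+1 * x_ (gF i) - x_ (gF i) * x_ (gE i) ^+ n.+1 =
  x_ (gE i) ^+ n * (qnat (q i i) n.+1 *: x_ (gK i) - qnat (q i i)^-1 n.+1 *: x_ (gL i)).
Proof.
elim: n => [|n ih].
  by rewrite !expr1 expr0 mul1r !qnatS !qnat0 !expr0 !add0r !scale1r calU_EF eqxx scale1r.
rewrite [x_ _ ^+ n.+2]exprS.
have -> (e f y : calU chi) : e * y * f - f * (e * y) = e * (y * f - f * y) + (e * f - f * e) * y.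
  by rewrite mulrBr mulrBl !mulrA addrA subrK.
rewrite ih calU_EF eqxx scale1r mulrBl calU_KX calU_LX mulrA -exprS.
rewrite [qnat _ n.+2]qnatS [qnat _^-1 n.+2]qnatS !scalerDl opprD addrACA [RHS]mulrDr.
by congr (_ + _); rewrite exprVn mulrBr -!scalerAr.
Qed.

End CalURelations.

Section Nilpotency.
Variables (k : fieldType) (I : finType) (chi : bichar k I) (p : I) (n : nat).
Local Notation x_ := (calUgen chi).
Local Notation q := (qij chi).
Hypothesis qn : qnat (q p p) n.+1 = 0.

(** The ideal of U^+ generated by E_p^(n+1); it is given inductively so that its
   stability under the skew derivations can be checked generator by generator. *)
Inductive powideal : calU chi -> Prop :=
| powideal0 : powideal 0
| powidealX : powideal (x_ (gE p) ^+ n.+1)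
| powidealD x y : powideal x -> powideal y -> powideal (x + y)
| powidealMl a x : calUplus a -> powideal x -> powideal (a * x)
| powidealMr a x : calUplus a -> powideal x -> powideal (x * a).

Lemma calUplusX x m : calUplus x -> @calUplus _ _ chi (x ^+ m).
Proof.
move=> hx; elim: m => [|m ih]; last by rewrite exprS; exact: in_subalgM.
by rewrite expr0 -(scale1r 1); exact: in_subalgC.
Qed.

Lemma calUplus0 : @calUplus _ _ chi 0.
Proof. by rewrite -(scale0r 1); exact: in_subalgC. Qed.

Lemma calUplusE i : @calUplus _ _ chi (x_ (gE i)).
Proof. by apply: in_subalgS; exists i. Qed.

Lemma calUplusZ c x : calUplus x -> @calUplus _ _ chi (c *: x).
Proof. by rewrite -mulr_algl; apply: in_subalgM; exact: in_subalgC. Qed.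

Lemma calUplus_conjK i x : calUplus x -> calUplus (x_ (gK i) * x * x_ (gKV i)).
Proof.
elim=> {x} [c|_ [j ->]|x y _ hx _ hy|x y _ hx _ hy].
- by rewrite mulr_algr -scalerAl calU_KV; exact: in_subalgC.
- by rewrite calU_KE -scalerAl -mulrA calU_KV mulr1; exact/calUplusZ/calUplusE.
- by rewrite mulrDr mulrDl; exact: in_subalgD.
have -> : x_ (gK i) * (x * y) * x_ (gKV i) =
    (x_ (gK i) * x * x_ (gKV i)) * (x_ (gK i) * y * x_ (gKV i)).
  by rewrite !mulrA -(mulrA (_ * _) (x_ (gKV i)) (x_ (gK i))) calU_VK mulr1.
exact: in_subalgM.
Qed.

Lemma calUplus_conjL i x : calUplus x -> calUplus (x_ (gLV i) * x * x_ (gL i)).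
Proof.
elim=> {x} [c|_ [j ->]|x y _ hx _ hy|x y _ hx _ hy].
- by rewrite mulr_algr -scalerAl calU_VL; exact: in_subalgC.
- have -> : x_ (gLV i) * x_ (gE j) * x_ (gL i) = q j i *: x_ (gE j).
    rewrite -mulrA (_ : x_ (gE j) * x_ (gL i) = q j i *: (x_ (gL i) * x_ (gE j))).
      by rewrite -scalerAr mulrA calU_VL mul1r.
    by rewrite calU_LE scalerA mulfV ?scale1r ?bichar_neq0.
  exact/calUplusZ/calUplusE.
- by rewrite mulrDr mulrDl; exact: in_subalgD.
have -> : x_ (gLV i) * (x * y) * x_ (gL i) =
    (x_ (gLV i) * x * x_ (gL i)) * (x_ (gLV i) * y * x_ (gL i)).
  by rewrite !mulrA -(mulrA (_ * _) (x_ (gL i)) (x_ (gLV i))) calU_LV mulr1.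
exact: in_subalgM.
Qed.

Lemma powideal_conjK i x : powideal x -> powideal (x_ (gK i) * x * x_ (gKV i)).
Proof.
have conjM a b : x_ (gK i) * (a * b) * x_ (gKV i) =
    (x_ (gK i) * a * x_ (gKV i)) * (x_ (gK i) * b * x_ (gKV i)).
  by rewrite !mulrA -(mulrA (_ * _) (x_ (gKV i)) (x_ (gK i))) calU_VK mulr1.
elim=> {x} [||x y _ hx _ hy|a x ha _ hx|a x ha _ hx].
- by rewrite mulr0 mul0r; exact: powideal0.
- rewrite calU_KX -scalerAl -mulrA calU_KV mulr1 -mulr_algl.
  by apply: powidealMl; [exact: in_subalgC|exact: powidealX].
- by rewrite mulrDr mulrDl; exact: powidealD.
- by rewrite conjM; apply: powidealMl => //; exact: calUplus_conjK.
- by rewrite conjM; apply: powidealMr => //; exact: calUplus_conjK.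
Qed.

(** The skew Leibniz rule: moving K_i to the right past b, and L_i to the left past
   a, conjugates these factors. *)
Lemma partialKM i a b a' b' : partialK i a a' -> partialK i b b' ->
  partialK i (a * b) (a * b' + a' * (x_ (gK i) * b * x_ (gKV i))).
Proof.
move=> [ha ha' [a'' [ha'' ea]]] [hb hb' [b'' [hb'' eb]]].
split; first exact: in_subalgM.
  by apply: in_subalgD; apply: in_subalgM => //; exact: calUplus_conjK.
exists ((x_ (gLV i) * a * x_ (gL i)) * b'' + a'' * b); split.
  by apply: in_subalgD; apply: in_subalgM => //; exact: calUplus_conjL.
have -> : a * b * x_ (gF i) - x_ (gF i) * (a * b) =
    a * (b * x_ (gF i) - x_ (gF i) * b) + (a * x_ (gF i) - x_ (gF i) * a) * b.
  by rewrite mulrBr mulrBl !mulrA addrA subrK.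
rewrite ea eb mulrBr mulrBl mulrDl mulrDr !mulrA calU_LV mul1r.
by rewrite -(mulrA _ (x_ (gKV i))) calU_VK mulr1 opprD addrACA.
Qed.

Lemma partialK_gen i j : partialK i (x_ (gE j)) ((j == i)%:R *: 1).
Proof.
have h1 : @calUplus _ _ chi ((j == i)%:R *: 1) by exact: in_subalgC.
split; [exact: calUplusE|by []|exists ((j == i)%:R *: 1); split => //].
rewrite calU_EF mulr_algl mulr_algr -scalerBr.
by case: eqP => [->|]; rewrite ?scale0r.
Qed.

Lemma partialK_exists i a : calUplus a -> exists a', @partialK _ _ chi i a a'.
Proof.
elim=> {a} [c|_ [j ->]|x y _ [x' hx] _ [y' hy]|x y _ [x' hx] _ [y' hy]].
- exists 0; split; [exact: in_subalgC|exact: calUplus0|].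
  exists 0; split; first exact: calUplus0.
  by rewrite mulr0 mul0r mulr_algl mulr_algr !subrr.
- by exists ((j == i)%:R *: 1); exact: partialK_gen.
- by exists (x' + y'); exact: partialKD.
- by eexists; exact: partialKM hx hy.
Qed.

Lemma qnatV0 : qnat (q p p)^-1 n.+1 = 0.
Proof. by rewrite qnatV ?bichar_neq0 // qn mulr0. Qed.

Lemma calU_EFcomm i j m : i != j ->
   x_ (gE i) ^+ m * x_ (gF j) = x_ (gF j) * x_ (gE i) ^+ m.
Proof.
move=> ij; apply/commr_sym/commrX/commr_sym.
by apply/eqP; rewrite -subr_eq0 calU_EF (negPf ij) scale0r.
Qed.

(** The skew derivatives of E_p^(n+1) vanish, since (n+1)_q = 0 forces the same at
   q^-1; the Leibniz rule and stability under conjugation by the K_i carry this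
   over to the whole ideal. *)
Lemma powideal_admissible : admissible powideal.
Proof.
split.
- move=> x; elim=> {x} [||x y _ hx _ hy|a x ha _ hx|a x ha _ hx].
  + exact: calUplus0.
  + exact/calUplusX/calUplusE.
  + exact: in_subalgD.
  + exact: in_subalgM.
  + exact: in_subalgM.
- exact: powideal0.
- exact: powidealD.
- exact: powidealMl.
- exact: powidealMr.
- move=> x; elim=> {x} [||x y _ hx _ hy|a x ha _ hx|a x ha _ hx].
  + exact: rmorph0.
  + by rewrite rmorphXn /= eps_gen expr0n.
  + by rewrite rmorphD /= hx hy addr0.
  + by rewrite rmorphM /= hx mulr0.
  + by rewrite rmorphM /= hx mul0r.
- move=> i x; elim=> {x} [||x y _ [x' px hx] _ [y' py hy]|a x ha jx [x' px hx]|a x ha jx [x' px hx]].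
  + exists 0; last exact: powideal0.
    split; [exact: calUplus0|exact: calUplus0|exists 0].
    by split; [exact: calUplus0|rewrite !(mulr0, mul0r)].
  + exists 0; last exact: powideal0.
    split; [exact/calUplusX/calUplusE|exact: calUplus0|exists 0].
    split; first exact: calUplus0.
    rewrite mulr0 mul0r subrr; have [->|ip] := eqVneq i p.
      by rewrite calU_EXF qn qnatV0 !scale0r subrr mulr0.
    by rewrite calU_EFcomm ?subrr // eq_sym.
  + by exists (x' + y'); [exact: partialKD|exact: powidealD].
  + have [a' pa] := partialK_exists i ha; have [_ ha' _] := pa.
    eexists; first exact: partialKM pa px.
    apply: powidealD; apply: powidealMl => //; exact: powideal_conjK.
  + have [a' pa] := partialK_exists i ha; have [_ ha' _] := pa.
    eexists; first exact: partialKM px pa.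
    by apply: powidealD; apply: powidealMr => //; exact: calUplus_conjK.
Qed.

(** E_p^(n+1) lies in the maximal ideal, and the antiautomorphism Omega transports
   this to F_p. *)
Lemma U_FX0 : Ugen chi (gF p) ^+ n.+1 = 0.
Proof.
have h : Iplus (x_ (gE p) ^+ n.+1) by exists powideal; [exact: powideal_admissible|exact: powidealX].
rewrite /Ugen -rmorphXn; apply/aproj_eq0; rewrite U_ideal.unlock; apply: in_idealS; right.
exists (x_ (gE p) ^+ n.+1) => //; elim: {h} n.+1 => [|m ih]; first by rewrite !expr0 rmorph1.
by rewrite exprSr ih exprS OmegaM Omega_gen.
Qed.

End Nilpotency.

(** * Relations in the quotient algebra *)

Section URelations.
Variables (k : fieldType) (I : finType) (chi : bichar k I).
Local Notation x_ := (Ugen chi).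
Local Notation q := (qij chi).

Lemma UprojM x y : @Uproj k I chi (x * y) = Uproj x * Uproj y.
Proof. exact: rmorphM. Qed.

Lemma UprojB x y : @Uproj k I chi (x - y) = Uproj x - Uproj y.
Proof. exact: rmorphB. Qed.

Lemma UprojZ c x : @Uproj k I chi (c *: x) = c *: Uproj x.
Proof. exact: linearZZ. Qed.

Lemma U_KV i : x_ (gK i) * x_ (gKV i) = 1.
Proof. by rewrite /Ugen -UprojM calU_KV rmorph1. Qed.

Lemma U_VK i : x_ (gKV i) * x_ (gK i) = 1.
Proof. by rewrite /Ugen -UprojM calU_VK rmorph1. Qed.

Lemma U_LV i : x_ (gL i) * x_ (gLV i) = 1.
Proof. by rewrite /Ugen -UprojM calU_LV rmorph1. Qed.

Lemma U_VL i : x_ (gLV i) * x_ (gL i) = 1.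
Proof. by rewrite /Ugen -UprojM calU_VL rmorph1. Qed.

Lemma U_KE i j : x_ (gK i) * x_ (gE j) = q i j *: (x_ (gE j) * x_ (gK i)).
Proof. by rewrite /Ugen -!UprojM calU_KE UprojZ. Qed.

Lemma U_LE i j : x_ (gL i) * x_ (gE j) = (q j i)^-1 *: (x_ (gE j) * x_ (gL i)).
Proof. by rewrite /Ugen -!UprojM calU_LE UprojZ. Qed.

Lemma U_KF i j : x_ (gK i) * x_ (gF j) = (q i j)^-1 *: (x_ (gF j) * x_ (gK i)).
Proof. by rewrite /Ugen -!UprojM calU_KF UprojZ. Qed.

Lemma U_LF i j : x_ (gL i) * x_ (gF j) = q j i *: (x_ (gF j) * x_ (gL i)).
Proof. by rewrite /Ugen -!UprojM calU_LF UprojZ. Qed.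

Lemma U_EF i j : x_ (gE i) * x_ (gF j) - x_ (gF j) * x_ (gE i) =
  (i == j)%:R *: (x_ (gK i) - x_ (gL i)).
Proof. by rewrite /Ugen -!UprojM -!UprojB calU_EF UprojZ. Qed.

Lemma U_EK i j : x_ (gE j) * x_ (gK i) = (q i j)^-1 *: (x_ (gK i) * x_ (gE j)).
Proof. by rewrite U_KE scalerA mulVf ?scale1r ?bichar_neq0. Qed.

Lemma U_EL i j : x_ (gE j) * x_ (gL i) = q j i *: (x_ (gL i) * x_ (gE j)).
Proof. by rewrite U_LE scalerA mulfV ?scale1r ?bichar_neq0. Qed.

Lemma U_EF_comm p i : i != p -> x_ (gE i) * x_ (gF p) = x_ (gF p) * x_ (gE i).
Proof. by move=> ip; apply/eqP; rewrite -subr_eq0 U_EF (negPf ip) scale0r. Qed.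

Lemma U_EF_pp p : x_ (gE p) * x_ (gF p) - x_ (gF p) * x_ (gE p) = x_ (gK p) - x_ (gL p).
Proof. by rewrite U_EF eqxx scale1r. Qed.

Lemma U_FLV p : x_ (gF p) * x_ (gLV p) = q p p *: (x_ (gLV p) * x_ (gF p)).
Proof.
have := U_LF p p => h.
rewrite -[x_ (gF p) in LHS]mul1r -(U_VL p) -(mulrA _ _ (x_ (gF p))) h.
by rewrite -!(scalerAr, scalerAl) -!mulrA U_LV mulr1.
Qed.

End URelations.

(** * Characters of the lattice *)

Section LatticeCharacters.
Variables (I : finType) (K : fieldType) (g : lattice I -> K).
Hypothesis gD : forall a b, g (a + b) = g a * g b.
Hypothesis g0 : forall a, g a != 0.

Lemma lchar0 : g 0 = 1.
Proof. by apply: (mulfI (g0 0)); rewrite -gD addr0 mulr1. Qed.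

Lemma lcharN a : g (- a) = (g a)^-1.
Proof. by apply: (mulfI (g0 a)); rewrite -gD subrr lchar0 mulfV. Qed.

Lemma lcharMn a n : g (a *+ n) = g a ^+ n.
Proof. by elim: n => [|n ih]; rewrite ?lchar0 // mulrS gD ih exprS. Qed.

Lemma lcharMz a (n : int) : g (a *~ n) = g a ^ n.
Proof.
case: n => n; first exact: lcharMn.
by rewrite NegzE mulrNz lcharN lcharMn.
Qed.

Lemma lchar_prod a : g a = \prod_i g (alpha i) ^ (a i).
Proof.
have aE : a = \sum_i alpha i *~ a i.
  apply/ffunP => j; rewrite sum_ffunE (bigD1 j) //= big1 => [|i /negPf ij].
    by rewrite ffunMzE ffunE eqxx addr0 mulrzz mul1r.
  by rewrite ffunMzE ffunE eq_sym ij mul0rz.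
rewrite [in LHS]aE (big_morph g gD lchar0).
by apply: eq_bigr => i _; rewrite lcharMz.
Qed.

End LatticeCharacters.

(** * The action on a Verma module *)

Lemma malgU_fbasis (K : fieldType) (X : choiceType) (c : K) (x : X) :
  << c *g x >> = c *: fbasis K x.
Proof.
by rewrite fbasis.unlock; apply/malgP => z; rewrite mcoeffZ !mcoeffU mulr_natr.
Qed.

Section VermaAction.
Variables (k K : fieldType) (iota : {rmorphism k -> K}) (I : finType).
Variables (chi : bichar k I) (Lam : tchar K I).
Local Notation x_ := (Ugen chi).
Local Notation M := (verma iota chi Lam).
Local Notation v := (vLam iota chi Lam).
Local Notation q := (qij chi).

Lemma tensor1 x c : tensor iota Lam x c = c *: vact x v.
Proof. by rewrite /vLam vactE mulr1 -tensorZ mulr1. Qed.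

(** Every tensor is a multiple of some x v, so these span the Verma module; most
   identities between additive maps on it are checked on them. *)
Lemma verma_ind (P : M -> Prop) :
  (forall m n, P m -> P n -> P (m + n)) ->
  (forall c x, P (c *: vact x v)) -> forall m, P m.
Proof.
move=> PD PZ m; have [g ->] := qprojP m.
have P0 : P 0 by have := PZ 0 0; rewrite scale0r.
rewrite (monalgE g); apply: (big_ind (fun z => P (qproj _ z))) => [||[x c] _].
- by rewrite linear0.
- by move=> a b ha hb; rewrite qprojD; exact: PD.
have -> : qproj (spanned (@tensor_rel k K iota I chi Lam)) << g@_(x, c) *g (x, c) >>
    = g@_(x, c) *: tensor iota Lam x c by rewrite malgU_fbasis linearZZ.
rewrite tensor1 scalerA.
exact: PZ.
Qed.

Lemma vactDr x (m n : M) : vact x (m + n) = vact x m + vact x n.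
Proof. exact: linearD. Qed.

Lemma vactZr x c (m : M) : vact x (c *: m) = c *: vact x m.
Proof. exact: linearZZ. Qed.

Lemma vact0r x : vact x (0 : M) = 0.
Proof. exact: linear0. Qed.

Lemma vactD (x y : U chi) (m : M) : vact (x + y) m = vact x m + vact y m.
Proof.
elim/verma_ind: m => [m n hm hn|c z]; first by rewrite !vactDr hm hn addrACA.
by rewrite -tensor1 !vactE mulrDl tensorDl.
Qed.

Lemma vactM (x y : U chi) (m : M) : vact (x * y) m = vact x (vact y m).
Proof.
elim/verma_ind: m => [m n hm hn|c z]; first by rewrite !vactDr hm hn.
by rewrite -tensor1 !vactE mulrA.
Qed.

Lemma vact1 (m : M) : vact 1 m = m.
Proof.
elim/verma_ind: m => [m n hm hn|c z]; first by rewrite vactDr hm hn.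
by rewrite -tensor1 !vactE mul1r.
Qed.

Lemma vact_torus x a b : vact (x * (Kexp chi a * Lexp chi b)) v = Lam a b *: vact x v.
Proof.
have := @tensor_bal _ _ iota _ chi Lam x a b 1 1; rewrite !rmorph1 !mulr1 => h.
by rewrite -tensor1 -h ?tensor1 ?scale1r // -(scale1r 1); exact: in_subalgC.
Qed.

Lemma Kexp0 : Kexp chi 0 = 1.
Proof. by rewrite /Kexp big1 // => i _; rewrite ffunE. Qed.

Lemma Lexp0 : Lexp chi 0 = 1.
Proof. by rewrite /Lexp big1 // => i _; rewrite ffunE. Qed.

Lemma tchar00 : Lam 0 0 = 1.
Proof. by apply: (mulfI (tchar_neq0 Lam 0 0)); rewrite -tcharD !addr0 mulr1. Qed.

Lemma vact_eps x E : calUplus E ->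
  vact (x * Uproj E) v = iota (eps E) *: vact x v.
Proof.
move=> hE; have := @tensor_bal _ _ iota _ chi Lam x 0 0 E 1 hE.
by rewrite Kexp0 Lexp0 tchar00 !mul1r mulr1 !tensor1 scale1r.
Qed.

(** The balancing relation for the scalar c in U^+ moves c across the tensor sign,
   where the augmentation sends it to its image in K. *)
Lemma vactZ c (x : U chi) (m : M) : vact (c *: x) m = iota c *: vact x m.
Proof.
elim/verma_ind: m => [m n hm hn|d z]; first by rewrite !vactDr hm hn scalerDr.
rewrite -tensor1 !vactE !tensor1 scalerA mulrC -scalerA; congr (_ *: _).
have := @vact_eps (x * z) c%:A (in_subalgC _ _).
rewrite epsZ rmorph1 mulr1 => <-; rewrite linearZZ rmorph1 mulr_algr.
by rewrite scalerAl.
Qed.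

Lemma vactB (x y : U chi) (m : M) : vact (x - y) m = vact x m - vact y m.
Proof. by rewrite -scaleN1r vactD vactZ rmorphN1 scaleN1r. Qed.

Lemma zexp_alpha x xV (i j : I) :
  @zexp k I chi x xV (alpha i j) = if j == i then x else 1.
Proof. by rewrite ffunE; case: eqP; rewrite /= ?expr1 ?expr0. Qed.

Lemma Kexp_alpha i : Kexp chi (alpha i) = x_ (gK i).
Proof.
rewrite /Kexp (eq_bigr (fun j => if j == i then x_ (gK j) else 1)) => [|j _]; last exact: zexp_alpha.
by rewrite -big_mkcond /= big_pred1_eq.
Qed.

Lemma Lexp_alpha i : Lexp chi (alpha i) = x_ (gL i).
Proof.
rewrite /Lexp (eq_bigr (fun j => if j == i then x_ (gL j) else 1)) => [|j _]; last exact: zexp_alpha.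
by rewrite -big_mkcond /= big_pred1_eq.
Qed.

Lemma vact_K i : vact (x_ (gK i)) v = Lam (alpha i) 0 *: v.
Proof. by rewrite -[v in RHS]vact1 -vact_torus Lexp0 Kexp_alpha mulr1 mul1r. Qed.

Lemma vact_L i : vact (x_ (gL i)) v = Lam 0 (alpha i) *: v.
Proof. by rewrite -[v in RHS]vact1 -vact_torus Kexp0 Lexp_alpha !mul1r. Qed.

Lemma vact_E i : vact (x_ (gE i)) v = 0.
Proof.
have := @vact_eps 1 (calUgen chi (gE i)) (calUplusE _ _).
by rewrite eps_gen /= rmorph0 scale0r mul1r.
Qed.

Section PowersOfF.
Variable p : I.
Local Notation w n := (vact (x_ (gF p) ^+ n) v).

Lemma vact_KFX i n :
  vact (x_ (gK i)) (w n) = (iota (q i p) ^- n * Lam (alpha i) 0) *: w n.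
Proof.
elim: n => [|n ih]; first by rewrite expr0 invr1 mul1r vact1 vact_K.
rewrite exprS vactM -vactM U_KF vactZ vactM ih vactZr scalerA mulrA.
by rewrite fmorphV exprS invfM.
Qed.

Lemma vact_LFX i n :
  vact (x_ (gL i)) (w n) = (iota (q p i) ^+ n * Lam 0 (alpha i)) *: w n.
Proof.
elim: n => [|n ih]; first by rewrite expr0 mul1r vact1 vact_L.
by rewrite exprS vactM -vactM U_LF vactZ vactM ih vactZr scalerA mulrA exprS.
Qed.

(** At n = 0 the truncated predecessor is harmless, as the quantum integer vanishes
   there. *)
Definition verma_coef n : K :=
  iota (qnat (q p p) n) * (iota (q p p) ^- n.-1 * Lam (alpha p) 0 - Lam 0 (alpha p)).

(** The rank one computation: E_p F_p - F_p E_p = K_p - L_p acts on F_p^m v by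
   q^-m Lambda(K_p) - q^m Lambda(L_p); the sum over m <= n is a multiple of
   (n+1)_q. *)
Lemma vact_EFX n : vact (x_ (gE p)) (w n.+1) = verma_coef n.+1 *: w n.
Proof.
have q0 : iota (q p p) != 0 by rewrite fmorph_eq0 bichar_neq0.
have step m : vact (x_ (gE p)) (w m.+1) = vact (x_ (gF p)) (vact (x_ (gE p)) (w m)) +
   (iota (q p p) ^- m * Lam (alpha p) 0 - iota (q p p) ^+ m * Lam 0 (alpha p)) *: w m.
  rewrite scalerBl -vact_KFX -vact_LFX -vactB (exprS (x_ (gF p)) m) vactM -(vactM (x_ (gE p))).
  have := U_EF chi p p; rewrite eqxx scale1r => /eqP.
  by rewrite subr_eq addrC => /eqP ->; rewrite (vactD (_ * _)) vactM.
elim: n => [|n ih].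
  rewrite step expr0 vact1 vact_E vact0r add0r /verma_coef /= qnatS qnat0 !expr0.
  by rewrite add0r rmorph1 invr1 !mul1r.
rewrite step ih vactZr -vactM -exprS -scalerDl; congr (_ *: _).
rewrite /verma_coef /=; set N := iota (qnat (q p p) n.+1).
have e1 : iota (qnat (q p p) n.+2) = 1 + iota (q p p) * N.
  by rewrite qnatSl rmorphD rmorphM rmorph1.
have e2 : iota (qnat (q p p) n.+2) = N + iota (q p p) ^+ n.+1.
  by rewrite qnatS rmorphD rmorphXn.
rewrite [RHS]mulrBr {1}e1 e2 exprS; field.
by rewrite q0 expf_neq0.
Qed.

Lemma vact_EiFX i n : i != p -> vact (x_ (gE i)) (w n) = 0.
Proof.
move=> ip; rewrite -vactM.
have -> : x_ (gE i) * x_ (gF p) ^+ n = x_ (gF p) ^+ n * x_ (gE i).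
  by apply: commrX; apply/eqP; rewrite -subr_eq0 U_EF (negPf ip) scale0r.
by rewrite vactM vact_E vact0r.
Qed.

End PowersOfF.
End VermaAction.

Section VermaFString.
Variables (k K : fieldType) (iota : {rmorphism k -> K}) (I : finType).
Variables (chi : bichar k I) (Lam : tchar K I) (p : I).
Local Notation x_ := (Ugen chi).
Local Notation M := (verma iota chi Lam).
Local Notation v := (vLam iota chi Lam).
Local Notation q := (qij chi).
Local Notation w n := (vact (x_ (gF p) ^+ n) v).

Lemma vact_eigenV (x xV : U chi) (m : M) c : xV * x = 1 -> c != 0 ->
  vact x m = c *: m -> vact xV m = c^-1 *: m.
Proof.
move=> xVx c0 h; rewrite -[m in RHS]vact1 -xVx vactM h vactZr scalerA mulVf //.
by rewrite scale1r.
Qed.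

Lemma vact_torusV_FX t n : t = x_ (gKV p) \/ t = x_ (gLV p) ->
  exists2 c, c != 0 & vact t (w n) = c *: w n.
Proof.
have q0 i j : iota (q i j) != 0 by rewrite fmorph_eq0 bichar_neq0.
case=> ->.
  exists (iota (q p p) ^- n * Lam (alpha p) 0)^-1.
    by rewrite invr_eq0 mulf_neq0 ?tchar_neq0 ?invr_neq0 ?expf_neq0.
  apply: (vact_eigenV (U_VK _ _) _ (vact_KFX iota chi Lam p p n)).
  by rewrite mulf_neq0 ?tchar_neq0 ?invr_neq0 ?expf_neq0.
exists (iota (q p p) ^+ n * Lam 0 (alpha p))^-1.
  by rewrite invr_eq0 mulf_neq0 ?tchar_neq0 ?expf_neq0.
apply: (vact_eigenV (U_VL _ _) _ (vact_LFX iota chi Lam p p n)).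
by rewrite mulf_neq0 ?tchar_neq0 ?expf_neq0.
Qed.

(** The F_p-string of v is stable under E_p and the torus and is killed by E_i, hence
   by every iterated q-commutator of E_p with E_i. *)
Lemma vact_adstep_FX i t tV m n : i != p ->
  tV = x_ (gKV p) \/ tV = x_ (gLV p) ->
  vact (iter m (adstep (x_ (gE p)) t tV) (x_ (gE i))) (w n) = 0.
Proof.
move=> ip htV; elim: m n => [|m ih] n; first exact: vact_EiFX.
rewrite iterS /adstep; set y := iter m _ _ in ih *.
rewrite vactB vactM ih vact0r sub0r !vactM.
suff -> : vact y (vact tV (vact (x_ (gE p)) (w n))) = 0 by rewrite vact0r oppr0.
case: n => [|n]; first by rewrite expr0 vact1 vact_E !vact0r.
have [c c0 hc] := vact_torusV_FX n htV.
by rewrite vact_EFX !vactZr hc vactZr ih !scaler0.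
Qed.

(** The quantum integer is nonzero by the minimality of b, the other factor by the
   genericity of Lambda. *)
Lemma verma_coef_neq0 b n : border chi (alpha p) = Some b ->
  (forall t : nat, (1 <= t <= b.-1)%N ->
     Lam (alpha p) (- alpha p) != iota (q p p ^+ t.-1)) ->
  (n.+1 < b)%N -> verma_coef iota chi Lam p n.+1 != 0.
Proof.
move=> /ominSP[_ hmin] hL nb.
have q0 : iota (q p p) != 0 by rewrite fmorph_eq0 bichar_neq0.
rewrite mulf_neq0 // ?fmorph_eq0.
  by apply/negP => h; have := hmin n.+1 h; rewrite leqNgt nb.
have nb1 : (1 <= n.+1 <= b.-1)%N by lia.
move: (hL _ nb1).
apply: contraNneq => /eqP; rewrite subr_eq0 /= => /eqP e.
have -> : Lam (alpha p) (- alpha p) = Lam (alpha p) 0 / Lam 0 (alpha p).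
  apply: (mulIf (tchar_neq0 Lam 0 (alpha p))); rewrite -tcharD addr0 addNr.
  by rewrite divfK ?tchar_neq0.
by rewrite -e invfM invrK mulrCA mulfV ?tchar_neq0 // mulr1 rmorphXn.
Qed.

End VermaFString.

(** * Bijectivity from the inverse of a Lusztig isomorphism *)

Section Bijectivity.
Variables (k K : fieldType) (iota : {rmorphism k -> K}) (I : finType).
Variables (chi : bichar k I) (p : I) (b : nat) (Lam : tchar K I).
Hypothesis hb : border chi (alpha p) = Some b.
Hypothesis hLam : forall t : nat, (1 <= t <= b.-1)%N ->
     Lam (alpha p) (- alpha p) != iota (chi (alpha p) (alpha p) ^+ t.-1).
Local Notation chi' := (rbichar p chi).
Local Notation Lam' := (tp iota chi p b Lam).
Local Notation x_ := (Ugen chi).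
Local Notation x' := (Ugen chi').
Local Notation M := (verma iota chi Lam).
Local Notation M' := (verma iota chi' Lam').
Local Notation v := (vLam iota chi Lam).
Local Notation v' := (vLam iota chi' Lam').
Local Notation w' n := (vact (x' (gF p) ^+ n) v').
Local Notation w := (w' b.-1).
Local Notation s := (sigma chi p).

Lemma border_refl : border chi' (alpha p) = Some b.
Proof. by rewrite -hb /border -!/(qij _ p p) qij_refl_pp. Qed.

Lemma border_gt0 : (0 < b)%N.
Proof. by have [/andP[]] := ominSP hb. Qed.

Lemma qnat_border : qnat (qij chi p p) b = 0.
Proof. by have [/andP[_ /eqP]] := ominSP hb. Qed.

Lemma chi0r (psi : bichar k I) a : psi a 0 = 1.
Proof. by rewrite -(mulr0n 0) bicharMnr. Qed.

Lemma chi0l (psi : bichar k I) a : psi 0 a = 1.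
Proof. by rewrite -(mulr0n 0) bicharMnl. Qed.

(** The twist in the definition of t_p compensates the weight of F_p^(b-1), so that
   the torus acts on F_p^(b-1) v' through Lambda composed with sigma_p. *)
Lemma vact_K_reflected i : vact (x' (gK i)) w = Lam (s (alpha i)) 0 *: w.
Proof.
rewrite vact_KFX; congr (_ *: _).
rewrite /= raddf0 chi0r expr1n mul1r /qij /= sigma_alphap bicharNr.
rewrite fmorphV rmorphV ?unitfE ?expf_neq0 ?bichar_neq0 // rmorphXn exprVn invrK.
by rewrite mulrCA mulfV ?mulr1 // expf_neq0 // fmorph_eq0 bichar_neq0.
Qed.

Lemma vact_L_reflected i : vact (x' (gL i)) w = Lam 0 (s (alpha i)) *: w.
Proof.
rewrite vact_LFX; congr (_ *: _).
rewrite /= raddf0 chi0l expr1n invr1 mulr1 /qij /= sigma_alphap bicharNl.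
rewrite fmorphV rmorphXn exprVn.
by rewrite mulrCA mulVf ?mulr1 // expf_neq0 // fmorph_eq0 bichar_neq0.
Qed.

(** Genericity is symmetric under the reflection: t_p(Lambda)(K_p L_p^-1) is
   q^(2(b-1)) Lambda(K_p L_p^-1)^-1, and q^b = 1, so the forbidden value for t
   corresponds to the forbidden value of Lambda for b - t. *)
Lemma reflected_generic (t : nat) : (1 <= t <= b.-1)%N ->
  Lam' (alpha p) (- alpha p) != iota (qij chi' p p ^+ t.-1).
Proof.
move=> /andP[t0 tb]; rewrite qij_refl_pp.
have tb' : (1 <= b - t <= b.-1)%N by have := border_gt0; lia.
apply: contraNneq (hLam tb') => h; apply/eqP.
have q0 : iota (qij chi p p) != 0 by rewrite fmorph_eq0 bichar_neq0.
have qb : iota (qij chi p p) ^+ b = 1.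
  by rewrite -rmorphXn expr_qnat0 ?rmorph1 // qnat_border.
have LE : Lam (- alpha p) (alpha p) = (Lam (alpha p) (- alpha p))^-1.
  apply: (mulfI (tchar_neq0 Lam (alpha p) (- alpha p))).
  by rewrite -tcharD subrr addNr tchar00 mulfV ?tchar_neq0.
move: h; rewrite /= !raddfN /= sigma_alphap opprK LE bicharNl -/(qij chi p p).
rewrite exprVn invrK -exprD !rmorphXn => h.
have -> : Lam (alpha p) (- alpha p) = iota (qij chi p p) ^+ (b.-1 + b.-1) / iota (qij chi p p) ^+ t.-1.
  by rewrite -h invfM invrK mulrCA mulfV ?mulr1 // expf_neq0.
apply: (mulIf (expf_neq0 t.-1 q0)); rewrite divfK ?expf_neq0 // -exprD.
have -> : (b.-1 + b.-1 = b + ((b - t).-1 + t.-1))%N by have := border_gt0; lia.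
by rewrite exprD qb mul1r.
Qed.

Variables (T : {lrmorphism U chi' -> U chi}) (g : U chi -> U chi').
Hypothesis TK : cancel T g.
Hypothesis KT : cancel g T.
Hypothesis hKL : lusztig_torus p T.

Lemma ginv_D x y : g (x + y) = g x + g y.
Proof. by apply: (can_inj TK); rewrite rmorphD /= !KT. Qed.
Lemma ginv_M x y : g (x * y) = g x * g y.
Proof. by apply: (can_inj TK); rewrite rmorphM /= !KT. Qed.
Lemma ginv_1 : g 1 = 1.
Proof. by apply: (can_inj TK); rewrite rmorph1 /= !KT. Qed.
Lemma ginv_Z c x : g (c *: x) = c *: g x.
Proof. by apply: (can_inj TK); rewrite linearZZ /= !KT. Qed.
Lemma ginv_X x n : g (x ^+ n) = g x ^+ n.
Proof. by apply: (can_inj TK); rewrite rmorphXn /= !KT. Qed.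

(** For x in the torus and in U^+ the scalar c is to be the one by which x acts on v;
   this makes [back_map] well defined. *)
Definition eigen (x : U chi) (c : K) := vact (g x) w = c *: w.

Lemma eigen1 : eigen 1 1.
Proof. by rewrite /eigen ginv_1 vact1 scale1r. Qed.

Lemma eigenM x y c d : eigen x c -> eigen y d -> eigen (x * y) (c * d).
Proof.
by rewrite /eigen ginv_M vactM => hx ->; rewrite vactZr hx scalerA mulrC.
Qed.

Lemma eigenX x c n : eigen x c -> eigen (x ^+ n) (c ^+ n).
Proof.
move=> hx; elim: n => [|n ih]; first exact: eigen1.
by rewrite !exprS; exact: eigenM.
Qed.

Lemma eigenV x xV c : xV * x = 1 -> c != 0 -> eigen x c -> eigen xV c^-1.
Proof. by move=> h; apply: vact_eigenV; rewrite -ginv_M h ginv_1. Qed.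

Lemma eigen_zexp x xV c n : xV * x = 1 -> c != 0 -> eigen x c ->
  eigen (zexp x xV n) (c ^ n).
Proof.
move=> h c0 hx; case: n => n; first exact: eigenX.
by rewrite /zexp NegzE -exprnN -exprVn; exact/eigenX/(eigenV h).
Qed.

Section TorusEigen.
Variables (h : lattice I -> K) (X XV : I -> U chi) (X' : I -> U chi').
Hypothesis hD : forall a b, h (a + b) = h a * h b.
Hypothesis h0 : forall a, h a != 0.
Hypothesis XXV : forall i, X i * XV i = 1.
Hypothesis XVX : forall i, XV i * X i = 1.
Hypothesis TXp : T (X' p) = XV p.
Hypothesis TXi : forall i, i != p -> T (X' i) = X i * X p ^+ ncartan chi' p i.
Hypothesis X'w : forall i, vact (X' i) w = h (s (alpha i)) *: w.

(** T^-1(X_p) is the inverse of X'_p and T^-1(X_i) = X'_i X'_p^m; both are read off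
   from the values of T, and applying sigma_p twice gives back alpha_i. *)
Lemma eigen_gen i : eigen (X i) (h (alpha i)).
Proof.
have XVp : eigen (XV p) (h (- alpha p)).
  by rewrite /eigen -TXp TK X'w sigma_alphap.
have [->|ip] := eqVneq i p.
  rewrite -[alpha p]opprK (lcharN hD h0); exact: eigenV (XXV p) _ XVp.
have -> : X i = (X i * X p ^+ ncartan chi' p i) * XV p ^+ ncartan chi' p i.
  rewrite -mulrA -exprMn_comm ?XXV ?expr1n ?mulr1 //.
  by rewrite /GRing.comm XXV XVX.
have -> : h (alpha i) = h (s (alpha i)) * h (- alpha p) ^+ ncartan chi' p i.
  rewrite sigma_alphaj // hD (lcharMn hD h0) ncartan_refl //; last exact: pfinite_border hb.
  by rewrite (lcharN hD h0) exprVn mulfK // expf_neq0.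
by apply/eigenM/eigenX => //; rewrite -TXi // /eigen TK X'w.
Qed.

Lemma eigen_exp (a : lattice I) : eigen (\prod_i zexp (X i) (XV i) (a i)) (h a).
Proof.
rewrite (lchar_prod hD h0 a); elim/big_rec2: _ => [|i c x _ hx]; first exact: eigen1.
by apply: eigenM hx; exact: eigen_zexp (XVX i) (h0 _) (eigen_gen i).
Qed.

End TorusEigen.

Lemma eigen_KL a c : eigen (Kexp chi a * Lexp chi c) (Lam a c).
Proof.
have [TKp TLp TKi TLi] := hKL.
rewrite -[a]addr0 -[c]add0r tcharD addr0 add0r; apply: eigenM.
  apply: (@eigen_exp (fun a => Lam a 0) _ _ (fun i => x' (gK i))) => //.
  - by move=> d e; rewrite -tcharD addr0.
  - by move=> d; exact: tchar_neq0.
  - exact: U_KV.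
  - exact: U_VK.
  - exact: vact_K_reflected.
apply: (@eigen_exp (fun a => Lam 0 a) _ _ (fun i => x' (gL i))) => //.
- by move=> d e; rewrite -tcharD addr0.
- by move=> d; exact: tchar_neq0.
- exact: U_LV.
- exact: U_VL.
- exact: vact_L_reflected.
Qed.

Hypothesis gE0 : forall i, vact (g (x_ (gE i))) w = 0.

Lemma eigen_plus E : calUplus E -> eigen (Uproj E) (iota (eps E)).
Proof.
elim=> {E} [c|_ [i ->]|x y _ hx _ hy|x y _ hx _ hy].
- rewrite epsZ rmorph1 mulr1 UprojZ /eigen rmorph1 ginv_Z ginv_1.
  by rewrite vactZ vact1.
- by rewrite eps_gen /eigen gE0 rmorph0 scale0r.
- rewrite /eigen !rmorphD ginv_D vactD.
  by rewrite hx hy scalerDl.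
- by rewrite !rmorphM; exact: eigenM.
Qed.

Definition back_map0 (z : U chi * K) : M' := z.2 *: vact (g z.1) w.

Lemma back_map_rel z : spanned (@tensor_rel k K iota I chi Lam) z -> flift back_map0 z = 0.
Proof.
have B : {morph flift back_map0 : x y / x - y} := linearB (flift back_map0).
have D : {morph flift back_map0 : x y / x + y} := linearD (flift back_map0).
have Z a x : flift back_map0 (a *: x) = a *: flift back_map0 x by exact: linearZZ.
have e x c : flift back_map0 (fbasis K (x, c)) = c *: vact (g x) w by exact: fliftU.
elim=> {z} [|z|x y _ hx _ hy|a x _ hx].
- exact: linear0.
- case=> [x y c|x c d|f x c|x a d E c hE]; rewrite B ?D ?Z !e.
  + by rewrite ginv_D vactD scalerDr subrr.
  + by rewrite scalerDl subrr.
  + by rewrite scalerA subrr.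
  + rewrite ginv_M vactM (eigenM (eigen_KL a d) (eigen_plus hE)) vactZr scalerA.
    by rewrite mulrC subrr.
- by rewrite D hx hy addr0.
- by rewrite Z hx scaler0.
Qed.

(** The map u v |-> T^-1(u) F_p^(b-1) v', opposite to the one whose bijectivity is
   at stake; it is a left inverse of the latter up to a scalar. *)
Definition back_map : M -> M' := qlift back_map_rel.

Lemma back_mapD x y : back_map (x + y) = back_map x + back_map y.
Proof. exact: linearD. Qed.

Lemma back_mapE c x : back_map (c *: vact x v) = c *: vact (g x) w.
Proof. by rewrite -tensor1 /back_map /tensor qliftE; exact: fliftU. Qed.

Hypothesis gF_lower : forall n, (n.+1 < b)%N ->
  exists2 c, c != 0 & vact (g (x_ (gF p))) (w' n.+1) = c *: w' n.

Lemma vact_gFX n : (n < b)%N ->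
  exists2 c, c != 0 & vact (g (x_ (gF p)) ^+ n) (w' n) = c *: v'.
Proof.
elim: n => [_|n ih nb]; first by exists 1; rewrite ?oner_neq0 // !expr0 !vact1 scale1r.
have [c c0 hc] := ih (ltnW nb); have [d d0 hd] := gF_lower nb.
exists (d * c); first exact: mulf_neq0.
by rewrite exprSr vactM hd vactZr hc scalerA.
Qed.

Lemma vact_EX_FX n : (n < b)%N ->
  exists2 c, c != 0 & vact (x_ (gE p) ^+ n) (vact (x_ (gF p) ^+ n) v) = c *: v.
Proof.
elim: n => [_|n ih nb]; first by exists 1; rewrite ?oner_neq0 // !expr0 !vact1 scale1r.
have [c c0 hc] := ih (ltnW nb).
exists (verma_coef iota chi Lam p n.+1 * c).
  by rewrite mulf_neq0 // (verma_coef_neq0 hb hLam).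
by rewrite exprSr vactM vact_EFX vactZr hc scalerA.
Qed.

Variable That : {linear M' -> M}.
Hypothesis hThat : forall u, That (vact u v') = vact (T u * x_ (gF p) ^+ b.-1) v.

(** The composite with [back_map] multiplies by the scalar by which
   T^-1(F_p)^(b-1) F_p^(b-1) acts on v'; this gives injectivity.  Surjectivity
   holds because E_p^(b-1) F_p^(b-1) v is a nonzero multiple of v and T is
   surjective. *)
Lemma verma_map_bijective : bijective That.
Proof.
have [b1 bb] : (b.-1 < b)%N /\ b = b.-1.+1 by have := border_gt0; lia.
have [c c0 hc] := vact_gFX b1; have [d d0 hd] := vact_EX_FX b1.
have ThatE e u : That (e *: vact u v') = e *: vact (T u * x_ (gF p) ^+ b.-1) v.
  by rewrite linearZZ hThat.
have STK m : back_map (That m) = c *: m.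
  elim/verma_ind: m => [m n hm hn|e u]; first by rewrite linearD back_mapD hm hn scalerDr.
  rewrite ThatE back_mapE ginv_M TK ginv_X vactM hc vactZr !scalerA.
  by rewrite mulrC.
have Tsurj m : exists n, That n = m.
  elim/verma_ind: m => [m n [m' hm] [n' hn]|e u]; first by exists (m' + n'); rewrite linearD hm hn.
  exists ((e / d) *: vact (g (u * x_ (gE p) ^+ b.-1)) v').
  by rewrite ThatE KT !vactM hd vactZr scalerA divfK.
exists (fun m => c^-1 *: back_map m) => [m|m].
  by rewrite STK scalerA mulVf ?scale1r.
by have [n <-] := Tsurj m; rewrite STK scalerA mulVf ?scale1r.
Qed.

End Bijectivity.

(** * Lusztig isomorphisms on root vectors *)

Section CartanCoefficients.
Variables (k : fieldType) (I : finType).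
Implicit Types (chi : bichar k I) (p i : I).

Lemma cartan_cond_lt chi p i n : (n < ncartan chi p i)%N -> ~~ cartan_cond chi p i n.
Proof.
rewrite /ncartan; case e: (omin _) => [m|//] /= nm; apply/negP => h.
by have [_ /(_ n h)] := ominSP e; rewrite leqNgt nm.
Qed.

(** All factors are nonzero by the minimality of the Cartan entry; when the minimum
   does not exist the product is empty. *)
Lemma lambda_neq0 chi p i : lambda chi p i != 0.
Proof.
have h n : (n < ncartan chi p i)%N -> (qnat (qij chi p p) n.+1 != 0) &&
    (qij chi p p ^+ n * qij chi p i * qij chi i p - 1 != 0).
  by move=> /cartan_cond_lt; rewrite /cartan_cond mulf_eq0 negb_or.
rewrite /lambda mulf_neq0 //; last first.
  by apply/prodf_neq0 => n _; have /andP[] := h n (ltn_ord n).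
rewrite /qfact big_seq; elim/big_ind: _ => [|x y|j]; first exact: oner_neq0.
  exact: mulf_neq0.
by rewrite mem_index_iota => /andP[]; case: j => // j _ /h /andP[].
Qed.

Lemma adcoef_neq0 chi p i n : (n < ncartan chi p i)%N ->
  adcoef (qij chi p p) (qij chi p i) (qij chi i p) n.+1 != 0.
Proof. by move=> /cartan_cond_lt; rewrite /cartan_cond /adcoef /= mulrA. Qed.

Lemma adcoefV_neq0 chi p i n : (n < ncartan chi p i)%N ->
  adcoef (qij chi p p)^-1 (qij chi i p)^-1 (qij chi p i)^-1 n.+1 != 0.
Proof.
move=> /cartan_cond_lt; rewrite /cartan_cond mulf_eq0 negb_or => /andP[h1 h2].
have q0 j l : qij chi j l != 0 by exact: bichar_neq0.
rewrite /adcoef qnatV // !mulf_neq0 ?invr_eq0 ?expf_neq0 //=.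
apply: contra h2; rewrite !subr_eq0 -invfM exprVn -invfM mulrA => /eqP/(congr1 GRing.inv).
by rewrite invrK invr1 mulrAC => ->.
Qed.

End CartanCoefficients.

Section LusztigOnRootVectors.
Variables (k : fieldType) (I : finType) (chi : bichar k I) (p : I).
Local Notation chi' := (rbichar p chi).
Local Notation x_ := (Ugen chi).
Local Notation x' := (Ugen chi').
Local Notation q := (qij chi).
Variable T : {lrmorphism U chi' -> U chi}.
Hypothesis hKL : lusztig_torus p T.

Lemma lusztig_torus_KV : T (x' (gKV p)) = x_ (gK p).
Proof.
have [TK _ _ _] := hKL.
rewrite -[LHS]mul1r -(U_KV chi p) -mulrA -TK -rmorphM /= U_KV.
by rewrite rmorph1 mulr1.
Qed.

Lemma lusztig_torus_LV : T (x' (gLV p)) = x_ (gL p).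
Proof.
have [_ TL _ _] := hKL.
rewrite -[LHS]mul1r -(U_LV chi p) -mulrA -TL -rmorphM /= U_LV.
by rewrite rmorph1 mulr1.
Qed.

(** T maps E_p to F_p L_p^-1 = q_pp L_p^-1 F_p, which is the descent situation. *)
Lemma lusztig_Eminus i d : i != p -> d != 0 ->
  T (x' (gE p)) = x_ (gF p) * x_ (gLV p) ->
  T (x' (gE i)) = d *: Eplus chi p i (ncartan chi p i) ->
  exists2 c, c != 0 & T (Eminus chi' p i (ncartan chi p i)) = c *: x_ (gE i).
Proof.
move=> ip d0 TE TEi; have [TKp TLp _ _] := hKL.
apply: (@adstep_descent _ _ (q p p) (q p i) (x_ (gE p)) (x_ (gK p)) (x_ (gKV p)) (x_ (gE i))
  _ _ _ (q i p) (x_ (gF p)) (x_ (gL p)) _ _ _ _ _ T (x_ (gLV p)) _ _ _ _ (q p p) d) => //.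
- exact: U_KV.
- exact: U_KE.
- exact: U_KE.
- exact: U_EL.
- exact: U_EL.
- exact: U_EF_pp.
- exact: U_EF_comm.
- exact: U_LV.
- exact: U_VL.
- by rewrite TE U_FLV.
- exact: lusztig_torus_LV.
- exact: bichar_neq0.
- by move=> n; exact: adcoef_neq0.
Qed.

(** The variant with K and L exchanged: E_p F_p - F_p E_p = K_p - L_p becomes the
   same relation with L_p - K_p on the right once F_p is replaced by - F_p. *)
Lemma lusztig_Eplus i d : i != p -> d != 0 ->
  T (x' (gE p)) = x_ (gKV p) * x_ (gF p) ->
  T (x' (gE i)) = d *: Eminus chi p i (ncartan chi p i) ->
  exists2 c, c != 0 & T (Eplus chi' p i (ncartan chi p i)) = c *: x_ (gE i).
Proof.
move=> ip d0 TE TEi; have [TKp TLp _ _] := hKL.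
apply: (@adstep_descent _ _ (q p p)^-1 (q i p)^-1 (x_ (gE p)) (x_ (gL p)) (x_ (gLV p)) (x_ (gE i))
  _ _ _ (q p i)^-1 (- x_ (gF p)) (x_ (gK p)) _ _ _ _ _ T (x_ (gKV p)) _ _ _ _ (-1) d) => //.
- exact: U_LV.
- exact: U_LE.
- exact: U_LE.
- exact: U_EK.
- exact: U_EK.
- by rewrite mulrN mulNr -opprD U_EF_pp opprB.
- by rewrite mulrN mulNr U_EF_comm.
- exact: U_KV.
- exact: U_VK.
- by rewrite TE mulrN scaleN1r opprK.
- exact: lusztig_torus_KV.
- by rewrite oppr_eq0 oner_neq0.
- by move=> n; exact: adcoefV_neq0.
Qed.

End LusztigOnRootVectors.

(** * The two maps are bijective *)

Theorem proposition5p11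
  (k K : fieldType) (iota : {rmorphism k -> K}) (I : finType)
  (chi : bichar k I) (p : I) (b : nat)
  (hb : border chi (alpha p) = Some b)
  (Lam : tchar K I)
  (hLam : forall t : nat, (1 <= t <= b.-1)%N ->
     Lam (alpha p) (- alpha p) != iota (chi (alpha p) (alpha p) ^+ t.-1))
  (T Tm : {lrmorphism U (rbichar p chi) -> U chi})
  (hT : lusztig p T) (hTm : lusztigV p Tm)
  (That Thatm : {linear verma iota (rbichar p chi) (tp iota chi p b Lam)
                   -> verma iota chi Lam})
  (hThat : forall u : U (rbichar p chi),
     That (vact u (vLam iota (rbichar p chi) (tp iota chi p b Lam))) =
     vact (T u * Ugen chi (gF p) ^+ b.-1) (vLam iota chi Lam))
  (hThatm : forall u : U (rbichar p chi),
     Thatm (vact u (vLam iota (rbichar p chi) (tp iota chi p b Lam))) =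
     vact (Tm u * Ugen chi (gF p) ^+ b.-1) (vLam iota chi Lam)) :
  bijective That /\ bijective Thatm.
Proof.
set chi' := rbichar p chi in hT hTm hThat hThatm *.
set Lam' := tp iota chi p b Lam in hThat hThatm *.
set v' := vLam iota chi' Lam' in hThat hThatm *.
have fin := pfinite_border hb.
have b1 : b = b.-1.+1 by have := border_gt0 hb; lia.
have Fb0 : vact (Ugen chi' (gF p) ^+ b) v' = 0.
  rewrite b1 U_FX0 -?b1; first by rewrite -(scale0r 0) vactZ rmorph0 scale0r.
  by rewrite qij_refl_pp (qnat_border hb).
have coef0 n : (n.+1 < b)%N -> verma_coef iota chi' Lam' p n.+1 != 0.
  exact: verma_coef_neq0 (border_refl hb) (reflected_generic hb hLam).
have EX i c (u : U chi') n : i != p -> c != 0 ->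
   u = Eplus chi' p i (ncartan chi p i) \/ u = Eminus chi' p i (ncartan chi p i) ->
   vact (c^-1 *: u) (vact (Ugen chi' (gF p) ^+ n) v') = 0.
  move=> ip c0 hu; rewrite vactZ; case: hu => ->; rewrite vact_adstep_FX ?scaler0 //.
    by left.
  by right.
split.
- have [[g TK KT] hKL TE TF TEi _] := hT.
  have TLV := lusztig_torus_LV hKL.
  apply: (@verma_map_bijective _ _ _ _ _ _ _ _ hb hLam T g TK KT hKL _ _ That hThat) => [i|n nb].
    have [->|ip] := eqVneq i p.
      have -> : g (Ugen chi (gE p)) = Ugen chi' (gKV p) * Ugen chi' (gF p).
        apply: (can_inj TK); rewrite KT rmorphM /= TF (lusztig_torus_KV hKL).
        by rewrite mulrA U_KV mul1r.
      by rewrite vactM -(vactM (Ugen chi' (gF p))) -exprS -b1 Fb0 vact0r.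
    have [|c c0 Tc] := lusztig_Eminus hKL ip (oner_neq0 _) TE.
      by rewrite scale1r TEi // ncartan_refl.
    have -> : g (Ugen chi (gE i)) = c^-1 *: Eminus chi' p i (ncartan chi p i).
      by apply: (can_inj TK); rewrite KT linearZZ /= Tc scalerA mulVf ?scale1r.
    by apply: (EX _ _ _ _ ip c0); right.
  have -> : g (Ugen chi (gF p)) = Ugen chi' (gE p) * Ugen chi' (gLV p).
    by apply: (can_inj TK); rewrite KT rmorphM /= TE TLV -mulrA U_VL mulr1.
  have [|d d0 hd] := @vact_torusV_FX _ _ iota _ chi' Lam' p (Ugen chi' (gLV p)) n.+1.
    by right.
  exists (d * verma_coef iota chi' Lam' p n.+1); first by rewrite mulf_neq0 ?coef0.
  by rewrite vactM hd vactZr vact_EFX scalerA.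
- have [[g TK KT] hKL TE TF TEi _] := hTm.
  apply: (@verma_map_bijective _ _ _ _ _ _ _ _ hb hLam Tm g TK KT hKL _ _ Thatm hThatm) => [i|n nb].
    have [->|ip] := eqVneq i p.
      have -> : g (Ugen chi (gE p)) = Ugen chi' (gF p) * Ugen chi' (gLV p).
        apply: (can_inj TK); rewrite KT rmorphM /= TF (lusztig_torus_LV hKL).
        by rewrite -mulrA U_VL mulr1.
      have [|d d0 hd] := @vact_torusV_FX _ _ iota _ chi' Lam' p (Ugen chi' (gLV p)) b.-1.
        by right.
      by rewrite vactM hd vactZr -vactM -exprS -b1 Fb0 scaler0.
    have l0 : (lambda (rbichar p (bicharV chi')) p i)^-1 != 0.
      by rewrite invr_eq0 lambda_neq0.
    have [|c c0 Tc] := lusztig_Eplus hKL ip l0 TE.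
      by rewrite TEi // ncartan_refl.
    have -> : g (Ugen chi (gE i)) = c^-1 *: Eplus chi' p i (ncartan chi p i).
      by apply: (can_inj TK); rewrite KT linearZZ /= Tc scalerA mulVf ?scale1r.
    by apply: (EX _ _ _ _ ip c0); left.
  have -> : g (Ugen chi (gF p)) = Ugen chi' (gKV p) * Ugen chi' (gE p).
    by apply: (can_inj TK); rewrite KT rmorphM /= TE (lusztig_torus_KV hKL) mulrA U_KV mul1r.
  have [|d d0 hd] := @vact_torusV_FX _ _ iota _ chi' Lam' p (Ugen chi' (gKV p)) n.
    by left.
  exists (verma_coef iota chi' Lam' p n.+1 * d); first by rewrite mulf_neq0 ?coef0.
  by rewrite vactM vact_EFX vactZr hd scalerA.
Qed.
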